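(* For $\theta\in[0,1]$ let $$A_\theta=\Bigl\{(x_k)_{k=1}^\infty\in\Sigma_2:\ \lim_{n\to\infty}\frac1n\sum_{k=1}^n x_kx_{2k}=\theta\Bigr\}.$$ For every $\theta\in(0,1)$, $$\dim_H(A_\theta)=f(\theta):=-\log_2(1-p)-\frac{\theta}{2}\log_2\Bigl[\frac{(1-q)(1-p)}{qp}\Bigr],$$ where $p=p(\theta)$ and $q=q(\theta)$ are determined by $$p^2q=(1-p)^3,\qquad 0<p<1,\qquad 0<q<1,\qquad \theta=\frac{2p(1-q)}{1+p+q}.$$ Moreover, $\dim_H(A_0)=\lim_{\theta\to0}f(\theta)=-\log_2(1-p)$, where $p\in(0,1)$ satisfies $p^2=(1-p)^3$, and $\dim_H(A_1)=\lim_{\theta\to1}f(\theta)=0$.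
   Context: $\Sigma_2=\{0,1\}^{\mathbb N}$, with $\mathbb N=\{1,2,3,\dots\}$, is the space of $0$-$1$ sequences $(x_k)_{k=1}^\infty$ equipped with the metric $\varrho((x_k),(y_k))=2^{-\min\{n:\ x_n\ne y_n\}}$ (and distance $0$ for equal sequences). $\dim_H$ denotes Hausdorff dimension with respect to this metric. *)

(* Defs.v *)
From HB Require Import structures.
From mathcomp Require Import all_boot all_order all_algebra.
From mathcomp Require Import all_classical all_reals all_analysis.

Set Implicit Arguments.
Unset Strict Implicit.
Unset Printing Implicit Defensive.

Import Order.TTheory GRing.Theory Num.Theory.
Import numFieldNormedType.Exports.

Local Open Scope classical_set_scope.
Local Open Scope ring_scope.

Section Hausdorff.
Context {R : realType} {T : metricType R}.
Implicit Types (A U : set T) (s delta : R).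

(* The maximum with 0 only serves to give the empty set diameter 0. *)
Definition diam U : \bar R :=
  maxe 0%E (ereal_sup [set (mdist u.1 u.2)%:E | u in U `*` U]).

(* The empty set has weight 0 also when s = 0, whereas 0 `^ 0 = 1. *)
Definition diam_pow s U : \bar R :=
  if U == set0 then 0%E else (diam U `^ s)%E.

Definition hausdorff_premeasure s delta A : \bar R :=
  ereal_inf [set (\sum_(0 <= k <oo) diam_pow s (U k))%E | U in
    [set U : (set T)^nat |
      A `<=` \bigcup_k U k /\ forall k, (diam (U k) <= delta%:E)%E]].

Definition hausdorff_measure s A : \bar R :=
  ereal_sup [set hausdorff_premeasure s delta A | delta in
    [set delta : R | 0 < delta]].

Definition hausdorff_dim A : \bar R :=
  ereal_inf [set s%:E | s in
    [set s : R | 0 <= s /\ hausdorff_measure s A = 0%E]].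

End Hausdorff.

(* A sequence (x_k) indexed by k >= 1 is stored with x_k at position k.-1.
   The parameter R is a phantom: it is where the metric takes its values. *)
Definition Sigma2 (R : realType) : Type := nat -> bool.

Section Sigma2_metric.
Variable R : realType.
Implicit Types x y z : Sigma2 R.

(* The successor of ex_minn undoes the index shift. *)
Definition Sigma2_dist x y : R :=
  if pselect (exists j : nat, x j != y j) is left xy
  then 2 ^- (ex_minn xy).+1 else 0.

Lemma Sigma2_dist_ltP x y n :
  reflect (forall j, (j < n)%N -> x j = y j) (Sigma2_dist x y < 2 ^- n).
Proof.
rewrite /Sigma2_dist; case: pselect => [xy|nxy].
  case: ex_minnP => m xym minm.
  rewrite ltf_pV2 ?posrE ?exprn_gt0// ltr_eXn2l ?ltr1n// ltnS.
  apply: (iffP idP) => [nm j jn|xyn].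
    apply/eqP; apply: contraT => /minm mj.
    by move: (leq_trans jn (leq_trans nm mj)); rewrite ltnn.
  by rewrite leqNgt; apply/negP => /xyn /eqP; rewrite (negbTE xym).
rewrite invr_gt0 exprn_gt0//; constructor => j _.
by apply/eqP; apply: contraT => xyj; case: nxy; exists j.
Qed.

Lemma Sigma2_dist_ge0 x y : 0 <= Sigma2_dist x y.
Proof.
by rewrite /Sigma2_dist; case: pselect => // xy; rewrite invr_ge0 exprn_ge0.
Qed.

Lemma Sigma2_distxx x : Sigma2_dist x x = 0.
Proof.
rewrite /Sigma2_dist; case: pselect => // xx.
by exfalso; case: xx => j; rewrite eqxx.
Qed.

Lemma Sigma2_dist_eq0 x y : Sigma2_dist x y = 0 -> x = y.
Proof.
move=> xy0; apply/funext => j.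
have /Sigma2_dist_ltP : Sigma2_dist x y < 2 ^- j.+1.
  by rewrite xy0 invr_gt0 exprn_gt0.
exact.
Qed.

Lemma Sigma2_dist_sym x y : Sigma2_dist x y = Sigma2_dist y x.
Proof.
rewrite /Sigma2_dist; case: pselect => [xy|nxy]; case: pselect => [yx|nyx] //.
- by congr (2 ^- _.+1); apply: eq_ex_minn => j; rewrite eq_sym.
- by case: nyx; case: xy => j xyj; exists j; rewrite eq_sym.
- by case: nxy; case: yx => j yxj; exists j; rewrite eq_sym.
Qed.

Lemma Sigma2_dist_triangle y x z :
  Sigma2_dist x z <= Sigma2_dist x y + Sigma2_dist y z.
Proof.
rewrite {1}/Sigma2_dist; case: pselect => [xz|_]; last first.
  by rewrite addr_ge0 ?Sigma2_dist_ge0.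
case: ex_minnP => m xzm _; rewrite leNgt; apply/negP => lt_m.
have /Sigma2_dist_ltP xy : Sigma2_dist x y < 2 ^- m.+1.
  by apply: le_lt_trans lt_m; rewrite lerDl Sigma2_dist_ge0.
have /Sigma2_dist_ltP yz : Sigma2_dist y z < 2 ^- m.+1.
  by apply: le_lt_trans lt_m; rewrite lerDr Sigma2_dist_ge0.
by move: xzm; rewrite xy// yz// eqxx.
Qed.

HB.instance Definition _ := Choice.copy (Sigma2 R) (nat -> bool).
HB.instance Definition _ := isMetric.Build R (Sigma2 R)
  Sigma2_distxx Sigma2_dist_eq0 Sigma2_dist_sym Sigma2_dist_triangle.

End Sigma2_metric.

(* The k-th term x_k, for k >= 1. *)
Definition digit (R : realType) (x : Sigma2 R) (k : nat) : R := (x k.-1)%:R.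

Definition level_set (R : realType) (theta : R) : set (Sigma2 R) :=
  [set x | n%:R^-1 * (\sum_(1 <= k < n.+1) digit x k * digit x (2 * k)%N)
             @[n --> \oo] --> theta].

Definition log2 (R : realType) (t : R) : R := ln t / ln 2.

Definition pq_system (R : realType) (theta p q : R) : Prop :=
  [/\ p ^+ 2 * q = (1 - p) ^+ 3, 0 < p < 1, 0 < q < 1 &
      theta = 2 * p * (1 - q) / (1 + p + q)].

Definition dim_formula (R : realType) (theta p q : R) : R :=
  - log2 (1 - p) - theta / 2 * log2 (((1 - q) * (1 - p)) / (q * p)).

(* Main.v *)
Require Import Defs.
From HB Require Import structures.
From mathcomp Require Import all_boot all_order all_algebra.
From mathcomp Require Import all_classical all_reals all_analysis.
From mathcomp Require Import ring lra zify.
Import Order.TTheory GRing.Theory Num.Theory.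
Import numFieldNormedType.Exports.
Local Open Scope classical_set_scope.
Local Open Scope ring_scope.

(** For odd i the digits x_i, x_(2i), x_(4i), ... form a chain, and different
    chains do not interact in the averages of x_k x_(2k). Let each chain be a
    Markov chain which puts a 1 after a 0, or at its start, with probability p,
    and a 0 after a 1 with probability q. The logarithm of the probability of the
    cylinder x_1 ... x_n is linear in n, in the numbers of ones among the first n
    and n/2 digits, and in the sum of x_k x_(2k) for k <= n/2. The relation
    p^2 q = (1 - p)^3 makes the two numbers of ones appear as N(n) - 2 N(n/2)
    (ln_weight), a quantity which is small compared to n whenever the frequency
    N(n) / n changes little between n/2 and n.

    Upper bound (level_set_dim_le). Along n = 2^j the frequency cannot always
    move in the unfavourable direction, as it is bounded. So for every x in the
    level set of theta, the cylinders of x have, for infinitely many n, a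
    probability of at least about 2^(- n F), where F = dim_formula theta p q.
    There are few such cylinders, and they cover the level set economically
    (hausdorff_dim_le). This holds for every point (p, q) of the curve.

    Lower bound (level_set_dim_ge). If theta = 2p(1 - q) / (1 + p + q), then
    almost every sequence has frequency of ones 2p / (1 + p + q), belongs to the
    level set, and has cylinders of probability about 2^(- n F). In place of a
    measure on sequences, the proof uses supermartingales on words: exponential
    ones that control the deviations from the law of large numbers, and one for
    each cylinder of a hypothetical cheap cover. A path which keeps their sum
    bounded is found greedily (greedy_path); it lies in the level set but avoids
    the cover.

    The equations for p and q have a unique solution because theta increases
    strictly along the curve, from the point p0 where q = 1 to p = 1
    (pq_system_mono, pq_system_exists). The formula extends continuously to both
    ends (continuous_curve_dim). At theta = 0 and theta = 1 the upper bounds for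
    points (p, q) that tend to the ends give the dimension, together with the
    lower bound for q = 1 at theta = 0, and the trivial one at theta = 1. *)

(** * Words and cylinders *)

Definition agree (n : nat) (x y : nat -> bool) : Prop :=
  forall k, (k < n)%N -> x k = y k.

Definition upd (x : nat -> bool) (n : nat) (b : bool) : nat -> bool :=
  fun k => if k == n then b else x k.

Lemma agree_sym {n x y} : agree n x y -> agree n y x.
Proof. by move=> xy k /xy. Qed.

Lemma agree_trans {n x y z} : agree n x y -> agree n y z -> agree n x z.
Proof. by move=> xy yz k kn; rewrite xy// yz. Qed.

Lemma agree_le {m n x y} : (m <= n)%N -> agree n x y -> agree m x y.
Proof. by move=> mn xy k km; apply: xy; apply: leq_trans mn. Qed.

Lemma agree_upd x n b : agree n x (upd x n b).
Proof. by move=> k kn; rewrite /upd ltn_eqF. Qed.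

Lemma agree_updS {n x y} : agree n x y -> agree n.+1 (upd x n (y n)) y.
Proof.
move=> xy k; rewrite ltnS /upd; case: eqVneq => [->//|kn] k_le.
by apply: xy; rewrite ltn_neqAle kn.
Qed.

(** What a function on finite words must satisfy when words of length n are
    represented by infinite sequences. *)
Definition local {R : realType} (g : nat -> (nat -> bool) -> R) : Prop :=
  forall n x y, agree n x y -> g n x = g n y.

(** Words are numbered like the nodes of a binary heap: the root is 1 and the
    children of i are 2i and 2i + 1, so that the words of length n get the
    numbers from 2 ^ n to 2 ^ n.+1 - 1. This turns a choice of cylinders into a
    sequence of sets whose sums can be regrouped by length. *)
Fixpoint code (x : nat -> bool) (n : nat) : nat :=
  if n is m.+1 then ((code x m).*2 + x m)%N else 1%N.

Definition decode (n i : nat) : nat -> bool :=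
  fun k => odd (i %/ 2 ^ (n - k.+1)).

Lemma decodeS n i (b : bool) :
  agree n.+1 (decode n.+1 (i.*2 + b)) (upd (decode n i) n b).
Proof.
move=> k; rewrite ltnS /decode /upd subSS; case: eqVneq => [->|kn] k_le.
  by rewrite subnn divn1 oddD odd_double; case: b.
have -> : (n - k = (n - k.+1).+1)%N by lia.
by rewrite expnS divnMA -[i.*2]muln2 divnMDl// (@divn_small b 2) ?addn0; case: (b).
Qed.

Lemma code_bounds x n : (2 ^ n <= code x n < 2 ^ n.+1)%N.
Proof.
elim: n => [//|n /andP[lo hi]] /=; move: lo hi; rewrite !expnS.
by case: (x n); lia.
Qed.

Lemma decode_code x n : agree n (decode n (code x n)) x.
Proof.
elim: n => [k //|n IHn] /=.
by apply: agree_trans (decodeS _ _ _) _; apply: agree_updS.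
Qed.

Lemma big_nat_double {R : realType} (F : nat -> R) a b : (a <= b)%N ->
  \sum_(a.*2 <= i < b.*2) F i = \sum_(a <= i < b) (F i.*2 + F i.*2.+1).
Proof.
move=> ab; rewrite -(subnK ab); elim: (b - a)%N => [|m IHm].
  by rewrite add0n !big_geq.
rewrite addSn doubleS big_nat_recr/=; last by lia.
rewrite big_nat_recr/=; last by lia.
by rewrite IHm big_nat_recr/= ?addrA//; lia.
Qed.

(** Splitting a word into its two children does not increase the total
    weight. *)
Lemma sum_level_le {R : realType} {W : nat -> (nat -> bool) -> R} : local W ->
  (forall n x, W n.+1 (upd x n false) + W n.+1 (upd x n true) <= W n x) ->
  forall n, \sum_(2 ^ n <= i < 2 ^ n.+1) W n (decode n i) <= W 0 xpred0.
Proof.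
move=> Wloc Wsub; elim=> [|n IHn].
  by rewrite big_nat1 (Wloc _ _ xpred0).
rewrite !(expnS 2 n.+1) !(expnS 2 n) !mul2n big_nat_double; last first.
  by rewrite -addnn leq_addr.
apply: le_trans IHn; rewrite expnS mul2n; apply: ler_sum => i _.
apply: le_trans (Wsub n (decode n i)).
rewrite (Wloc _ _ _ (agree_sym (decodeS n i false))).
rewrite (Wloc _ _ _ (agree_sym (decodeS n i true))).
by rewrite addn0 addn1.
Qed.

Lemma sum_dyadic {R : realType} (F : nat -> R) M :
  \sum_(1 <= i < 2 ^ M) F i = \sum_(n < M) \sum_(2 ^ n <= i < 2 ^ n.+1) F i.
Proof.
elim: M => [|M IHM]; first by rewrite big_ord0 big_geq.
by rewrite big_ord_recr/= -IHM -big_cat_nat//= ?expn_gt0// leq_exp2l.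
Qed.

(** Each level carries a total weight of at most 1, so that the damping factor
    leaves the tail of a geometric series. *)
Lemma sum_heap_le {R : realType} {W : nat -> (nat -> bool) -> R} {r : R} {m} :
  local W -> (forall n x, 0 <= W n x) ->
  (forall n x, W n.+1 (upd x n false) + W n.+1 (upd x n true) <= W n x) ->
  W 0 xpred0 <= 1 -> 0 <= r < 1 -> forall M,
  \sum_(1 <= i < M) (if (m <= trunc_log 2 i)%N then
     r ^+ trunc_log 2 i * W (trunc_log 2 i) (decode (trunc_log 2 i) i) else 0)
  <= r ^+ m / (1 - r).
Proof.
move=> Wloc W0 Wsub W1 /andP[r0 r1] M.
pose F i : R := if (m <= trunc_log 2 i)%N then
  r ^+ trunc_log 2 i * W (trunc_log 2 i) (decode (trunc_log 2 i) i) else 0.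
rewrite -[X in X <= _]/(\sum_(1 <= i < M) F i).
have F0 i : 0 <= F i by rewrite /F; case: ifP => // _; rewrite mulr_ge0 ?exprn_ge0.
have pM : (M <= 2 ^ M)%N by rewrite ltnW// ltn_expl.
apply: (@le_trans _ _ (\sum_(1 <= i < 2 ^ M) F i)).
  case: M pM => [|M] pM; first by rewrite big_geq// sumr_ge0.
  by rewrite [leRHS](@big_cat_nat _ _ _ M.+1)//= lerDl sumr_ge0.
rewrite sum_dyadic.
apply: (@le_trans _ _ (\sum_(n < M) if (m <= n)%N then r ^+ n else 0)).
  apply: ler_sum => n _.
  rewrite (eq_big_nat _ _ (F2 := fun i =>
     if (m <= n)%N then r ^+ n * W n (decode n i) else 0)); last first.
    by move=> i ni; rewrite /F (@trunc_log_eq 2 n i).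
  case: ifP => mn; last by rewrite big1.
  rewrite -mulr_sumr ler_piMr ?exprn_ge0//.
  exact: le_trans (sum_level_le Wloc Wsub n) W1.
have r10 : 0 < 1 - r by rewrite subr_gt0.
(* Stated without division, so that it telescopes. *)
have key : \sum_(n < M) (if (m <= n)%N then r ^+ n else 0) * (1 - r)
   <= r ^+ m - (if (m <= M)%N then r ^+ M else r ^+ m).
  elim: M {pM} => [|M IHM].
    by rewrite big_ord0 leqn0; case: ifP => [/eqP->|]; rewrite subrr.
  rewrite big_ord_recr/=; apply: le_trans (lerD IHM (lexx _)) _.
  have [mM|Mm|->] := ltngtP m M.+1; rewrite ?ltnn.
  - by rewrite -ltnS mM exprS; lra.
  - by rewrite leqNgt ltnW//=; lra.
  - by lra.
rewrite ler_pdivlMr// mulr_suml; apply: le_trans key _.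
by rewrite gerBl; case: ifP; rewrite exprn_ge0.
Qed.

(** * Hausdorff dimension through cylinders *)

Lemma expr_small {R : realType} {r e : R} : 0 <= r < 1 -> 0 < e ->
  exists m, forall n, (m <= n)%N -> r ^+ n <= e.
Proof.
move=> /andP[r0 r1] e0.
have r1' : `|r| < 1 by rewrite ger0_norm.
have /cvgrPdist_le /(_ e e0) [m _ mP] := cvg_expr r1'.
exists m => n /mP /=.
by rewrite sub0r normrN ger0_norm ?exprn_ge0.
Qed.

Lemma pow2N_itv {R : realType} (s : R) : 0 < s -> 0 <= (2 : R) `^ (- s) < 1.
Proof.
move=> s0; rewrite powR_ge0 /powR pnatr_eq0/= expR_lt1 mulNr oppr_lt0.
by rewrite mulr_gt0// ln_gt0// ltr1n.
Qed.

(** The s-th power of the size of a cylinder of length n; the right-hand side is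
    the form used from here on. *)
Lemma pow_cylinder {R : realType} (s : R) n :
  (2 ^- n) `^ s = (2 `^ (- s)) ^+ n :> R.
Proof.
by rewrite -powR_invn// -powRrM -powR_mulrn ?powR_ge0// -powRrM mulrC mulrN mulNr.
Qed.

Lemma diam_ge0 {R : realType} {T : metricType R} (U : set T) : (0 <= diam U)%E.
Proof. by rewrite /diam le_max lexx. Qed.

Lemma diam_pow_ge0 {R : realType} {T : metricType R} (s : R) (U : set T) :
  (0 <= diam_pow s U)%E.
Proof. by rewrite /diam_pow; case: ifP => // _; apply: poweR_ge0. Qed.

Lemma diam_agree_le {R : realType} (U : set (Sigma2 R)) n :
  (forall x y, U x -> U y -> agree n x y) -> (diam U <= (2 ^- n)%:E)%E.
Proof.
move=> Un; rewrite /diam ge_max lee_fin invr_ge0 exprn_ge0//=.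
apply: ge_ereal_sup => _ [[x y] [/= Ux Uy] <-]; rewrite lee_fin ltW//.
by apply/Sigma2_dist_ltP; apply: Un.
Qed.

Lemma diam_ge_dist {R : realType} {U : set (Sigma2 R)} {x y n} :
  U x -> U y -> x n != y n -> ((2 ^- n.+1)%:E <= diam U)%E.
Proof.
move=> Ux Uy xyn; rewrite /diam le_max; apply/orP; right.
apply: (@le_trans _ _ (Sigma2_dist x y)%:E); last first.
  by apply: ereal_sup_ubound; exists (x, y).
rewrite lee_fin leNgt; apply/negP => /Sigma2_dist_ltP /(_ n (ltnSn n)) xy.
by rewrite xy eqxx in xyn.
Qed.

Lemma diam_pow_agree_le {R : realType} (s : R) (U : set (Sigma2 R)) n :
  0 <= s -> (forall x y, U x -> U y -> agree n x y) ->
  (diam_pow s U <= ((2 `^ (- s)) ^+ n)%:E)%E.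
Proof.
move=> s0 Un; rewrite /diam_pow; case: ifP => _.
  by rewrite lee_fin exprn_ge0// powR_ge0.
rewrite -pow_cylinder -poweR_EFin; apply: gt0_ler_poweR => //.
- by rewrite in_itv/= diam_ge0 leey.
- by rewrite in_itv/= leey lee_fin invr_ge0 exprn_ge0.
- exact: diam_agree_le.
Qed.

Lemma hausdorff_measure_ge0 {R : realType} {T : metricType R} (s : R) (A : set T) :
  (0 <= hausdorff_measure s A)%E.
Proof.
apply: (@le_trans _ _ (hausdorff_premeasure s 1 A)); last first.
  by apply: ereal_sup_ubound; exists 1 => //=.
apply: le_ereal_inf_tmp => _ [U _ <-].
by apply: nneseries_ge0 => n _ _; apply: diam_pow_ge0.
Qed.

(** One half of the principle of Billingsley. Here W plays the part of a mass
    distribution. If s' is strictly between F and s, then the cylinders of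
    length n on which (2 `^ - s') ^+ n <= W cover A even when short ones are
    discarded, and the sum of the s-th powers of their diameters is at most that
    of r ^+ n * W with r = 2 `^ (s' - s) < 1, hence the tail of a geometric
    series. *)
Lemma hausdorff_dim_le {R : realType} (A : set (Sigma2 R))
    (W : nat -> (nat -> bool) -> R) (F : R) :
  local W -> (forall n x, 0 <= W n x) ->
  (forall n x, W n.+1 (upd x n false) + W n.+1 (upd x n true) <= W n x) ->
  W 0%N xpred0 <= 1 -> 0 <= F ->
  (forall s, F < s -> forall x, A x -> forall m,
     exists n, (m <= n)%N /\ (2 `^ (- s)) ^+ n <= W n x) ->
  (hausdorff_dim A <= F%:E)%E.
Proof.
move=> Wloc W0 Wsub W1 F0 AW; apply/lee_addgt0Pr => e e0.
rewrite -EFinD; apply: ereal_inf_lbound; exists (F + e) => //; split.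
  by rewrite addr_ge0// ltW.
apply/eqP; rewrite eq_le hausdorff_measure_ge0 andbT.
apply: ge_ereal_sup => _ [delta /= delta0 <-].
apply/lee_addgt0Pr => eta eta0; rewrite add0e.
set r : R := 2 `^ (- (e / 2)).
have r01 : 0 <= r < 1 by apply: pow2N_itv; rewrite divr_gt0.
have half01 : 0 <= (2 : R)^-1 < 1.
  by rewrite invr_ge0 ler0n/= invf_lt1 ?ltr1n.
have [m1 m1P] := expr_small half01 delta0.
have r10 : 0 < 1 - r by case/andP: r01 => _ r1; rewrite subr_gt0.
have [m2 m2P] := expr_small r01 (mulr_gt0 eta0 r10).
pose m := maxn m1 m2.
pose lvl := trunc_log 2.
pose good i := [&& (0 < i)%N, (m <= lvl i)%N &
  (2 `^ (- (F + e / 2))) ^+ lvl i <= W (lvl i) (decode (lvl i) i)].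
pose U i : set (Sigma2 R) :=
  if good i then [set x | agree (lvl i) x (decode (lvl i) i)] else set0.
have Uagree i x y : U i x -> U i y -> agree (lvl i) x y.
  by rewrite /U; case: ifP => // _ /= xi yi; apply: agree_trans (agree_sym yi).
pose v i := if (m <= lvl i)%N then
  r ^+ lvl i * W (lvl i) (decode (lvl i) i) else 0.
have Uv i : (0 < i)%N -> (diam_pow (F + e) (U i) <= (v i)%:E)%E.
  move=> i0; rewrite /v; case: (boolP (good i)) => gi; last first.
    rewrite /U (negbTE gi) /diam_pow eqxx lee_fin; case: ifP => // _.
    by rewrite mulr_ge0// exprn_ge0// powR_ge0.
  have [_ mi Wi] := and3P gi; rewrite mi.
  apply: le_trans (diam_pow_agree_le _ _ (lvl i) _ (Uagree i)) _.
    by rewrite addr_ge0// ltW.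
  rewrite lee_fin.
  have -> : - (F + e) = - (e / 2) + - (F + e / 2) by field.
  by rewrite powRD ?pnatr_eq0 ?implybT// exprMn ler_wpM2l// exprn_ge0.
apply: (@le_trans _ _ (\sum_(0 <= k <oo) diam_pow (F + e) (U k))%E).
  apply: ereal_inf_lbound; exists U => //; split=> [x Ax|k].
    have Fe : F < F + e / 2 by rewrite ltrDl divr_gt0.
    have [n [mn Wn]] := AW _ Fe x Ax m.
    exists (code x n) => //; rewrite /U /good /lvl.
    rewrite (@trunc_log_eq 2 n) ?code_bounds//.
    rewrite mn (Wloc _ _ _ (decode_code x n)) Wn andbT/=.
    have /andP[lo _] := code_bounds x n.
    rewrite (leq_trans _ lo) ?expn_gt0//=.
    exact: agree_sym (decode_code x n).
  case: (boolP (good k)) => gk.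
    apply: le_trans (diam_agree_le _ _ (Uagree k)) _.
    have [_ mk _] := and3P gk; rewrite lee_fin -exprVn m1P//.
    by apply: leq_trans mk; rewrite leq_maxl.
  apply: le_trans (diam_agree_le _ m1 _) _; last by rewrite lee_fin -exprVn m1P.
  by move=> x y; rewrite /U (negbTE gk).
apply: lime_le.
  by apply: is_cvg_nneseries => n _ _; apply: diam_pow_ge0.
near=> M.
have M0 : (0 < M)%N by near: M; exists 1%N.
rewrite big_ltn// {1}/diam_pow {1}/U ifT ?add0e; last by rewrite /good eqxx.
apply: (@le_trans _ _ (\sum_(1 <= i < M) (v i)%:E)%E).
  by rewrite !big_nat; apply: lee_sum => i /andP[i0 _]; apply: Uv.
rewrite sumEFin lee_fin.
apply: le_trans (sum_heap_le Wloc W0 Wsub W1 r01 M) _.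
by rewrite ler_pdivrMr// m2P// leq_maxr.
Unshelve. all: by end_near.
Qed.

(** Every set lies in a cylinder of comparable diameter: cut at the first place
    where two of its points differ. For a single point, eta > 0 leaves room for a
    long cylinder. *)
Lemma cylinder_cover {R : realType} (s eta : R) (U : set (Sigma2 R)) :
  0 <= s -> 0 < eta -> exists ny : nat * (nat -> bool), forall x, U x ->
    agree ny.1 ny.2 x /\
    (((2 `^ (- s)) ^+ ny.1)%:E <= (2 `^ s)%:E * diam_pow s U + eta%:E)%E.
Proof.
move=> s0 eta0; have [->|/set0P [y Uy]] := eqVneq U set0.
  by exists (0%N, xpred0) => x.
have Un0 : (U == set0) = false by apply/negbTE/set0P; exists y.
have [[n0 dn0]|nod] := pselect (exists n, `[< exists2 z, U z & y n != z n >]).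
  have exn : exists n, `[< exists2 z, U z & y n != z n >] by exists n0.
  have [n /asboolP [z Uz yz] nmin] := ex_minnP exn.
  exists (n, y) => x Ux /=; split=> [k kn|].
    apply/eqP; apply: contraT => yxk.
    have /nmin : `[< exists2 z, U z & y k != z k >] by apply/asboolP; exists x.
    by rewrite leqNgt kn.
  rewrite /diam_pow Un0.
  apply: (@le_trans _ _ ((2 `^ s)%:E * (2 ^- n.+1)%:E `^ s)%E); last first.
    rewrite -[leLHS]adde0; apply: leeD; last by rewrite lee_fin ltW.
    apply: lee_wpmul2l; first by rewrite lee_fin powR_ge0.
    apply: gt0_ler_poweR => //.
    - by rewrite in_itv/= leey lee_fin invr_ge0 exprn_ge0.
    - by rewrite in_itv/= diam_ge0 leey.
    - exact: diam_ge_dist Uy Uz yz.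
  rewrite poweR_EFin -EFinM lee_fin pow_cylinder exprS mulrA.
  by rewrite -powRD ?pnatr_eq0 ?implybT// subrr powRr0 mul1r.
have Uy1 x : U x -> y = x.
  move=> Ux; apply/funext => n; apply/eqP; apply: contraT => yxn; case: nod.
  by exists n; apply/asboolP; exists x.
have [s_eq0|s_neq0] := eqVneq s 0.
  exists (0%N, y) => x Ux; split=> //=.
  rewrite /diam_pow Un0 s_eq0 powRr0 poweRe0 mul1e expr0 -EFinD lee_fin.
  by rewrite lerDl ltW.
have r01 : 0 <= (2 : R) `^ (- s) < 1 by apply: pow2N_itv; rewrite lt0r s_neq0.
have [m mP] := expr_small r01 eta0.
exists (m, y) => x /Uy1 <-; split=> //=.
apply: (@le_trans _ _ eta%:E); first by rewrite lee_fin mP.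
by rewrite leeDr// mule_ge0 ?diam_pow_ge0// lee_fin powR_ge0.
Qed.

(** Lower bounds only require cylinder covers to be excluded. A cover is given
    with prices w that dominate the s-th powers of the sizes; a cylinder whose
    price is too low covers nothing, which is how the empty sets of an arbitrary
    cover are treated. *)
Lemma hausdorff_dim_ge {R : realType} (A : set (Sigma2 R)) (F : R) :
  (forall s, 0 <= s < F -> exists2 c : R, 0 < c &
    forall (n : nat -> nat) (y : nat -> nat -> bool) (w : nat -> R),
    (forall i, 0 <= w i) ->
    (forall x, A x -> exists i,
       agree (n i) (y i) x /\ (2 `^ (- s)) ^+ n i <= w i) ->
    ~ (forall N, \sum_(i < N) w i <= c)) ->
  (F%:E <= hausdorff_dim A)%E.
Proof.
move=> AF; apply: le_ereal_inf_tmp => _ [s [s0 As] <-].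
rewrite lee_fin leNgt; apply/negP => sF.
have [|c c0 noc] := AF s; first by rewrite s0.
have p2 : 0 < (2 : R) `^ s by rewrite powR_gt0.
have : (hausdorff_premeasure s 1 A < (c / 2 / 2 `^ s)%:E)%E.
  apply: (@le_lt_trans _ _ (hausdorff_measure s A)).
    by apply: ereal_sup_ubound; exists 1 => //=.
  by rewrite As lte_fin !divr_gt0.
move=> /ereal_inf_lt [_ [U [AU _] <-]] Usum.
pose eta (i : nat) : R := c / 2 * (2^-1 ^+ i.+1).
have eta0 i : 0 < eta i by rewrite mulr_gt0 ?divr_gt0// exprn_gt0 ?invr_gt0.
have [ny nyP] := choice (fun i => cylinder_cover s (eta i) (U i) s0 (eta0 i)).
have sumU N : (\sum_(i < N) diam_pow s (U i) < (c / 2 / 2 `^ s)%:E)%E.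
  apply: le_lt_trans Usum; rewrite -(big_mkord xpredT (fun i => diam_pow s (U i))).
  by apply: nneseries_lim_ge => i _ _; apply: diam_pow_ge0.
have Ufin i : diam_pow s (U i) \is a fin_num.
  rewrite ge0_fin_numE ?diam_pow_ge0//.
  apply: le_lt_trans (lt_trans (sumU i.+1) (ltey _)).
  rewrite big_ord_recr/= leeDr// sume_ge0// => j _; exact: diam_pow_ge0.
pose w i := 2 `^ s * fine (diam_pow s (U i)) + eta i.
apply: (noc (fun i => (ny i).1) (fun i => (ny i).2) w).
- move=> i; rewrite addr_ge0 ?mulr_ge0 ?powR_ge0 ?fine_ge0 ?diam_pow_ge0//.
  exact: ltW.
- move=> x /AU [i _ Uix]; exists i; have [ag le_w] := nyP i x Uix; split=> //.
  by rewrite -lee_fin /w EFinD EFinM fineK.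
- move=> N; rewrite big_split/= -mulr_sumr.
  have -> : c = 2 `^ s * (c / 2 / 2 `^ s) + c / 2 by field; rewrite gt_eqF.
  apply: lerD.
    rewrite ler_pM2l// -lee_fin -sumEFin; apply: le_trans (ltW (sumU N)).
    by apply: lee_sum => i _; rewrite fineK.
  rewrite -mulr_sumr ler_piMr ?divr_ge0 ?(ltW c0)//.
  suff -> : \sum_(i < N) 2^-1 ^+ i.+1 = 1 - 2^-1 ^+ N :> R.
    by rewrite gerBl exprn_ge0.
  elim: N => [|N IHN]; first by rewrite big_ord0 expr0 subrr.
  by rewrite big_ord_recr/= IHN exprS; field.
Qed.

(** * Greedy paths of supermartingales *)

(** A nonnegative supermartingale for the random sequence in which, after the
    word x of length n, the next digit is b with probability t n x b. *)
Record supermart {R : realType} (t : nat -> (nat -> bool) -> bool -> R)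
    (g : nat -> (nat -> bool) -> R) : Prop := Supermart {
  supermart_local : local g;
  supermart_ge0 : forall n x, 0 <= g n x;
  supermart_step : forall n x,
    t n x false * g n.+1 (upd x n false) + t n x true * g n.+1 (upd x n true)
      <= g n x }.

Lemma supermartD {R : realType} {t : nat -> (nat -> bool) -> bool -> R} {g h} :
  supermart t g -> supermart t h -> supermart t (fun n x => g n x + h n x).
Proof.
move=> [gl g0 gs] [hl h0 hs]; split=> [n x y xy|n x|n x].
- by rewrite (gl _ _ _ xy) (hl _ _ _ xy).
- by rewrite addr_ge0.
- by rewrite !mulrDr addrACA lerD.
Qed.

Lemma supermartZ {R : realType} {t : nat -> (nat -> bool) -> bool -> R} {g} (c : R) :
  0 <= c -> supermart t g -> supermart t (fun n x => c * g n x).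
Proof.
move=> c0 [gl g0 gs]; split=> [n x y xy|n x|n x].
- by rewrite (gl _ _ _ xy).
- by rewrite mulr_ge0.
- by rewrite ![_ * (c * _)]mulrCA -mulrDr ler_wpM2l.
Qed.

(** A substitute for a probability measure on sequences. If the sum of countably
    many supermartingales is at most c at the root, then at every node some child
    of positive probability keeps the sum at most c, because an average of
    numbers greater than c is greater than c. Following such children yields a
    sequence along which no supermartingale of the family ever exceeds c. *)
Lemma greedy_path {R : realType} (t : nat -> (nat -> bool) -> bool -> R)
    (g : nat -> nat -> (nat -> bool) -> R) (c : R) :
  (forall n x y b, agree n x y -> t n x b = t n y b) ->
  (forall n x b, 0 <= t n x b) -> (forall n x, t n x false + t n x true = 1) ->
  (forall i, supermart t (g i)) ->
  (forall N, \sum_(i < N) g i 0%N xpred0 <= c) ->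
  exists x, forall n, 0 < t n x (x n) /\ forall i, g i n x <= c.
Proof.
move=> tloc t0 t1 gs gc.
pose ok n x := forall N, \sum_(i < N) g i n x <= c.
have okloc n x y : agree n x y -> ok n x -> ok n y.
  move=> xy okx N; apply: le_trans (okx N); apply: ler_sum => i _.
  by rewrite (supermart_local _ _ (gs i) n x y).
have step n x : exists b, ok n x -> 0 < t n x b /\ ok n.+1 (upd x n b).
  apply: contrapT => /forallNP noc.
  have okx : ok n x by apply: contrapT => nok; apply: (noc true) => /nok.
  (* The alternative t n x b = 0 is kept: nothing is known of such a child. *)
  have bad b : exists N, forall M, (N <= M)%N ->
      t n x b = 0 \/ c < \sum_(i < M) g i n.+1 (upd x n b).
    have [tb0|tb0] := eqVneq (t n x b) 0; first by exists 0%N => M _; left.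
    have : ~ ok n.+1 (upd x n b).
      by move=> okb; apply: (noc b) => _; split=> //; rewrite lt0r tb0 t0.
    move=> /existsNP [N /negP]; rewrite -ltNge => cN; exists N => M NM; right.
    apply: lt_le_trans cN _; rewrite -(subnKC NM) big_split_ord/= lerDl.
    by apply: sumr_ge0 => i _; apply: supermart_ge0 (gs _) _ _.
  have [N0 bad0] := bad false; have [N1 bad1] := bad true.
  pose M := maxn N0 N1.
  pose S b := \sum_(i < M) g i n.+1 (upd x n b).
  have SM : t n x false * S false + t n x true * S true <= c.
    apply: le_trans (okx M); rewrite !mulr_sumr -big_split/=.
    by apply: ler_sum => i _; apply: supermart_step (gs i) _ _.
  have h0 := bad0 M (leq_maxl _ _); have h1 := bad1 M (leq_maxr _ _).
  have := t0 n x false; have := t0 n x true; have := t1 n x.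
  move: h0 h1 SM; rewrite -/(S false) -/(S true).
  move: (t n x false) (t n x true) (S false) (S true) => u v A B.
  move=> uA vB SM uv v0 u0; have v_eq : v = 1 - u by lra.
  case: uA vB => [u_eq0|cA] [v_eq0|cB].
  - by lra.
  - have v1 : v = 1 by lra.
    by move: SM; rewrite u_eq0 v1; lra.
  - have u1 : u = 1 by lra.
    by move: SM; rewrite u1 v_eq0; lra.
  pose d := Num.min A B.
  have cd : c < d by rewrite lt_min cA.
  have uA : 0 <= u * (A - d) by rewrite mulr_ge0// subr_ge0 ge_min lexx.
  have vB : 0 <= v * (B - d) by rewrite mulr_ge0// subr_ge0 ge_min lexx orbT.
  by move: vB SM; rewrite v_eq; lra.
have [f fP] := choice (fun nx : nat * (nat -> bool) => step nx.1 nx.2).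
pose hist := fix hist n :=
  if n is m.+1 then upd (hist m) m (f (m, hist m)) else xpred0.
pose x n := f (n, hist n).
have hx n : agree n (hist n) x.
  elim: n => [k //|n IHn] /=; exact: agree_updS IHn.
have okh n : ok n (hist n).
  by elim: n => [|n /(fP (n, hist n)) []//] /=; apply: gc.
exists x => n; split.
  rewrite -(tloc _ _ _ _ (hx n)).
  by have [] := fP (n, hist n) (okh n).
move=> i; have := okloc _ _ _ (hx n) (okh n) i.+1.
rewrite big_ord_recr/=; apply: le_trans; rewrite lerDr sumr_ge0// => j _.
exact: supermart_ge0 (gs _) _ _.
Qed.

(** * Markov weights on dyadic chains *)

(** The digit x_k sits at index n = k.-1, and par n x is x_(k/2) if k is even and
    0 if k is odd. With the convention that the missing digit is 0, the chains
    i, 2i, 4i, ... over odd i all follow one and the same transition kernel. *)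
Definition par (n : nat) (x : nat -> bool) : bool := odd n && x n./2.

Lemma half_lt n : odd n -> (n./2 < n)%N.
Proof. by case: n => // n _; rewrite ltnS /= leq_uphalf_double -addnn leq_addr. Qed.

Lemma par_agree {n x y} : agree n x y -> par n x = par n y.
Proof. by rewrite /par; case: (boolP (odd n)) => //= on -> //; apply: half_lt. Qed.

Lemma par_agreeS {n x y k} : agree n x y -> (k <= n)%N -> par k x = par k y.
Proof. by move=> xy kn; apply: par_agree; apply: agree_le xy. Qed.

Definition kern {R : realType} (p q : R) (a b : bool) : R :=
  if a then (if b then 1 - q else q) else (if b then p else 1 - p).

Definition weight {R : realType} (p q : R) (n : nat) (x : nat -> bool) : R :=
  \prod_(k < n) kern p q (par k x) (x k).

Definition ones {R : realType} (n : nat) (x : nat -> bool) : R :=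
  \sum_(k < n) (x k)%:R.

Definition pairs {R : realType} (n : nat) (x : nat -> bool) : R :=
  \sum_(k < n) (x k && x k.*2.+1)%:R.

Lemma sum_odd {R : realType} (F : nat -> R) n :
  \sum_(k < n) (if odd k then F k./2 else 0) = \sum_(j < n./2) F j.
Proof.
elim: n => [|n IHn]; first by rewrite !big_ord0.
rewrite big_ord_recr/= IHn uphalf_half; case: (odd n) => /=.
  by rewrite add1n big_ord_recr.
by rewrite addr0 add0n.
Qed.

Lemma sum_par {R : realType} n x : \sum_(k < n) (par k x)%:R = ones n./2 x :> R.
Proof.
apply: etrans (sum_odd (fun j => (x j)%:R : R) n); apply: eq_bigr => k _.
by rewrite /par; case: odd.
Qed.

Lemma sum_par_digit {R : realType} n x :
  \sum_(k < n) (par k x && x k)%:R = pairs n./2 x :> R.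
Proof.
apply: etrans (sum_odd (fun j => (x j && x j.*2.+1)%:R : R) n).
apply: eq_bigr => k _.
rewrite /par; case: (boolP (odd k)) => //= ok.
by rewrite -{2}(odd_double_half k) ok.
Qed.

Lemma level_setE {R : realType} (theta : R) (x : Sigma2 R) :
  level_set theta x <->
  n%:R^-1 * pairs n (x : nat -> bool) @[n --> \oo] --> theta.
Proof.
rewrite /level_set /=.
suff -> : (fun n => n%:R^-1 *
    (\sum_(1 <= k < n.+1) digit x k * digit x (2 * k)%N)) =
  (fun n => n%:R^-1 * pairs n (x : nat -> bool)) by [].
apply/funext => n; congr (_ * _).
rewrite big_add1/= big_mkord; apply: eq_bigr => k _.
by rewrite /digit mul2n doubleS -natrM mulnb.
Qed.

Lemma kern_ge0 {R : realType} {p q : R} : 0 <= p <= 1 -> 0 <= q <= 1 ->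
  forall a b, 0 <= kern p q a b.
Proof. by move=> /andP[p0 p1] /andP[q0 q1] [] [] /=; rewrite ?subr_ge0. Qed.

Lemma kern_sum {R : realType} (p q : R) a : kern p q a false + kern p q a true = 1.
Proof. by case: a => /=; ring. Qed.

Lemma weight_local {R : realType} (p q : R) : local (weight p q).
Proof.
move=> n x y xy; apply: eq_bigr => k _.
by rewrite xy// (par_agreeS xy)// ltnW.
Qed.

Lemma weight_ge0 {R : realType} {p q : R} : 0 <= p <= 1 -> 0 <= q <= 1 ->
  forall n x, 0 <= weight p q n x.
Proof. by move=> p01 q01 n x; apply: prodr_ge0 => k _; apply: kern_ge0. Qed.

Lemma prod_upd {R : realType} (phi : nat -> bool -> bool -> R) n x b :
  \prod_(k < n.+1) phi k (par k (upd x n b)) (upd x n b k) =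
  (\prod_(k < n) phi k (par k x) (x k)) * phi n (par n x) b.
Proof.
rewrite big_ord_recr/=; congr (_ * phi _ _ _).
- apply: eq_bigr => k _; rewrite -(agree_upd x n b)//.
  by rewrite -(par_agreeS (agree_upd x n b))// ltnW.
- by rewrite -(par_agree (agree_upd x n b)).
- by rewrite /upd eqxx.
Qed.

Lemma weight_split {R : realType} (p q : R) n x :
  weight p q n.+1 (upd x n false) + weight p q n.+1 (upd x n true) =
  weight p q n x.
Proof.
rewrite /weight !(prod_upd (fun=> kern p q)) -mulrDr.
by rewrite kern_sum mulr1.
Qed.

(** This is where p ^ 2 q = (1 - p) ^ 3 enters: it makes the coefficient of the
    parent digit equal to -2 times that of the digit itself. *)
Lemma ln_kern {R : realType} {p q : R} (p01 : 0 < p < 1) (q01 : 0 < q <= 1)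
    (pq : p ^+ 2 * q = (1 - p) ^+ 3) a b :
  0 < kern p q a b ->
  ln (kern p q a b) = ln (1 - p) + ln (p / (1 - p)) * (b%:R - 2 * a%:R)
    + ln ((1 - q) * (1 - p) / (q * p)) * (a && b)%:R.
Proof.
have /andP[p0 p1] := p01; have /andP[q0 q1] := q01.
have p1' : 0 < 1 - p by rewrite subr_gt0.
have lq : ln q = 3 * ln (1 - p) - 2 * ln p.
  have := congr1 (@ln R) pq.
  by rewrite lnM ?posrE ?exprn_gt0// !lnXn// => lpq; lra.
rewrite ln_div ?posrE//; case: a; case: b => /= k0; rewrite ?mulr0 ?mulr1.
- by rewrite !(ln_div, lnM) ?posrE ?mulr_gt0// lq; ring.
- by rewrite lq; ring.
- by ring.
- by ring.
Qed.

(** As a consequence of the coefficient -2, the counts of ones enter only as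
    ones n - 2 * ones n./2. For even n this is n times the increment of the
    frequency of the digit 1 between n/2 and n. *)
Lemma ln_weight {R : realType} {p q : R} (p01 : 0 < p < 1) (q01 : 0 < q <= 1)
    (pq : p ^+ 2 * q = (1 - p) ^+ 3) n x :
  (forall k, (k < n)%N -> 0 < kern p q (par k x) (x k)) ->
  ln (weight p q n x) = n%:R * ln (1 - p)
    + ln (p / (1 - p)) * (ones n x - 2 * ones n./2 x)
    + ln ((1 - q) * (1 - p) / (q * p)) * pairs n./2 x.
Proof.
move=> xpos; rewrite -sum_par -sum_par_digit /ones.
elim: n xpos => [|n IHn] xpos.
  by rewrite /weight !big_ord0 ln1; ring.
have npos k : (k < n)%N -> 0 < kern p q (par k x) (x k).
  by move=> kn; apply: xpos; apply: ltnW.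
rewrite /weight !big_ord_recr/= lnM ?posrE ?xpos ?prodr_gt0//; last first.
  by move=> k _; apply: npos.
rewrite -/(weight p q n x) IHn// (ln_kern p01 q01 pq) ?xpos// -natr1; ring.
Qed.

(** * Upper bound *)

Lemma dim_formulaE {R : realType} (theta p q : R) :
  dim_formula theta p q * ln 2 =
  - ln (1 - p) - theta / 2 * ln ((1 - q) * (1 - p) / (q * p)).
Proof. by rewrite /dim_formula /log2; field; rewrite gt_eqF// ln_gt0// ltr1n. Qed.

Lemma ones_bounds {R : realType} n x : 0 <= (ones n x : R) <= n%:R.
Proof.
apply/andP; split; first by apply: sumr_ge0.
rewrite -[n in n%:R]card_ord -sumr_const; apply: ler_sum => k _.
by case: (x k); rewrite ?ler01.
Qed.

(** A bounded sequence cannot drop by eps at every step. *)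
Lemma ex_small_drop {R : realType} (u : nat -> R) (B eps : R) J :
  (forall j, `|u j| <= B) -> 0 < eps ->
  exists j, (J <= j)%N /\ u j - eps <= u j.+1.
Proof.
move=> uB eps0; apply: contrapT => /forallNP noj.
have drop k : u (J + k)%N <= u J - k%:R * eps.
  elim: k => [|k IHk]; first by rewrite addn0 mul0r subr0.
  have : ~ (u (J + k)%N - eps <= u (J + k).+1).
    by move=> le_u; apply: (noj (J + k)%N); rewrite leq_addr.
  by move=> /negP; rewrite -ltNge addnS -natr1; lra.
have [k kP] : exists k : nat, 2 * B / eps < k%:R.
  by exists (Num.truncn (2 * B / eps)).+1; apply: truncnS_gt.
move: kP; rewrite ltr_pdivrMr// => kP; have := drop k.
have := uB J; have := uB (J + k)%N; rewrite !ler_norml.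
by move=> /andP[? ?] /andP[? ?] ?; lra.
Qed.

Lemma kern_gt0 {R : realType} {p q : R} : 0 < p < 1 -> 0 < q < 1 ->
  forall a b, 0 < kern p q a b.
Proof. by move=> /andP[p0 p1] /andP[q0 q1] [] [] /=; rewrite ?subr_gt0. Qed.

(** Every point (p, q) of the curve gives a bound for every level set, so that
    (p, q) can tend to an end of the curve when theta = 0 or theta = 1. Along
    n = 2 ^ j.+1 the frequencies of the digit 1 form a bounded sequence, so their
    increment is almost favourable for infinitely many j. For these the weight of
    the cylinder decays at a rate of at most dim_formula theta p q, up to eps. *)
Lemma level_set_dim_le {R : realType} (theta p q : R) :
  0 < p < 1 -> 0 < q < 1 -> p ^+ 2 * q = (1 - p) ^+ 3 ->
  0 <= dim_formula theta p q ->
  (hausdorff_dim (level_set theta) <= (dim_formula theta p q)%:E)%E.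
Proof.
move=> p01 q01 pq F0; have /andP[p0 p1] := p01; have /andP[q0 q1] := q01.
have p01' : 0 <= p <= 1 by rewrite !ltW.
have q01' : 0 <= q <= 1 by rewrite !ltW.
apply: (@hausdorff_dim_le _ _ (weight p q)) => //.
- exact: weight_local.
- by move=> n x; apply: weight_ge0.
- by move=> n x; rewrite weight_split.
- by rewrite /weight big_ord0.
move=> s Fs x /level_setE x_theta m.
have ln2 : 0 < ln 2 :> R by rewrite ln_gt0// ltr1n.
have FE := dim_formulaE theta p q.
set F := dim_formula theta p q in Fs FE.
set c := ln (p / (1 - p)); set D := ln ((1 - q) * (1 - p) / (q * p)) in FE *.
(* With half of the gap, the error terms below add up to 3/4 of it. *)
pose eps := (s - F) * ln 2 / 2.
have eps0 : 0 < eps by rewrite divr_gt0// mulr_gt0// subr_gt0.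
have D1 : 0 < `|D| + 1 by rewrite ltr_wpDl.
have [M _ MP] := (cvgrPdist_le _ _).1 x_theta _ (divr_gt0 eps0 D1).
pose u j : R := c * (ones (2 ^ j) x / (2 ^ j)%:R).
have uc j : `|u j| <= `|c|.
  have N0 : 0 < (2 ^ j)%:R :> R by rewrite ltr0n expn_gt0.
  have /andP[z0 zN] := @ones_bounds R (2 ^ j) x.
  rewrite /u normrM ler_piMr// ger0_norm ?divr_ge0 ?(ltW N0)//.
  by rewrite ler_pdivrMr// mul1r.
have [j [Jj uj]] := ex_small_drop u _ _ (maxn M m) uc eps0.
move: Jj; rewrite geq_max => /andP[Mj mj].
have jN : (j < 2 ^ j)%N by rewrite ltn_expl.
have S_theta := MP _ (ltnW (leq_ltn_trans Mj jN)); rewrite /= in S_theta.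
exists (2 ^ j.+1)%N; split.
  by rewrite ltnW// (leq_ltn_trans mj)// (leq_trans jN)// leq_exp2l.
have W0 : 0 < weight p q (2 ^ j.+1) x.
  by apply: prodr_gt0 => k _; apply: kern_gt0.
rewrite -ler_ln ?posrE ?exprn_gt0 ?powR_gt0// lnXn ?powR_gt0// ln_powR.
have q0le : 0 < q <= 1 by rewrite q0 ltW.
rewrite (ln_weight p01 q0le pq) => [|k _]; last exact: kern_gt0.
have N0 : 0 < (2 ^ j)%:R :> R by rewrite ltr0n expn_gt0.
have dbl : (2 ^ j).*2%:R = 2 * (2 ^ j)%:R :> R by rewrite -mul2n natrM.
move: uj; rewrite /u expnS mul2n doubleK -(mulr_natl (- s * ln 2)) dbl.
set N := (2 ^ j)%:R in N0 *; rewrite -/c -/D.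
set A := ones (2 ^ j).*2 x; set B := ones (2 ^ j) x.
set P := pairs (2 ^ j) x.
move=> uj.
have cAB : 0 <= c * (A - 2 * B) + N * 2 * eps.
  have <- : N * 2 * (c * (A / (2 * N)) - c * (B / N)) = c * (A - 2 * B).
    by field; rewrite gt_eqF.
  by rewrite -mulrDr !mulr_ge0 ?(ltW N0)//; lra.
have DP : - eps <= D * (N^-1 * P - theta).
  move: S_theta; rewrite ler_pdivlMr// distrC => S_theta.
  rewrite lerNl; apply: le_trans (ler_norm _) _; rewrite normrN normrM mulrC.
  apply: le_trans S_theta; rewrite ler_wpM2l// lerDl//.
have NDP : 0 <= D * P - N * (D * theta) + N * eps.
  have <- : N * (D * (N^-1 * P - theta)) = D * P - N * (D * theta).
    by field; rewrite gt_eqF.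
  by rewrite -mulrDr mulr_ge0 ?(ltW N0)//; lra.
have NF : N * eps >= 0 by rewrite mulr_ge0// ltW.
have Fln : N * 2 * (F * ln 2) = N * 2 * (- ln (1 - p) - theta / 2 * D).
  by rewrite FE.
by move: NF cAB NDP; rewrite /eps; lra.
Qed.

(** * Supermartingales for the Markov weights *)

Lemma expR_le_quad {R : realType} (z : R) : z <= 2^-1 ->
  expR z <= 1 + z + 2 * z ^+ 2.
Proof.
move=> z2; have z1 : 0 < 1 - z by lra.
have : expR z <= (1 - z)^-1.
  rewrite -[z in expR z]opprK expRN lef_pV2 ?posrE ?expR_gt0//.
  exact: expR_ge1Dx.
move=> /le_trans; apply; rewrite -[leRHS]mulr1 -ler_pdivrMl; last by nra.
by rewrite -invfM -invr1 lef_pV2 ?posrE ?mulr_gt0//; nra.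
Qed.

(** The one-step Chernoff bound for a centred variable with values in [-1, 1]. *)
Lemma exp_step {R : realType} (u v y z tau : R) :
  0 <= u -> 0 <= v -> u + v = 1 -> u * y + v * z = 0 ->
  `|y| <= 1 -> `|z| <= 1 -> `|tau| <= 2^-1 ->
  u * expR (tau * y - 2 * tau ^+ 2) + v * expR (tau * z - 2 * tau ^+ 2) <= 1.
Proof.
move=> u0 v0 uv mean y1 z1 tau2.
have bound w : `|w| <= 1 -> expR (tau * w) <= 1 + tau * w + 2 * tau ^+ 2.
  move=> w1; apply: le_trans (expR_le_quad _ _) _.
    apply: le_trans (ler_norm _) _; rewrite normrM.
    by apply: le_trans tau2; rewrite ler_piMr.
  rewrite lerD2l ler_pM2l// exprMn ler_piMr ?sqr_ge0//.
  by rewrite -real_normK ?num_real// expr_le1.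
have e2 : expR (- (2 * tau ^+ 2)) * (1 + 2 * tau ^+ 2) <= 1.
  rewrite expRN mulrC ler_pdivrMr ?expR_gt0// mul1r; exact: expR_ge1Dx.
rewrite !expRD; apply: le_trans e2.
have := ler_wpM2l u0 (bound _ y1); have := ler_wpM2l v0 (bound _ z1).
move=> vz uy; rewrite mulrCA [v * _]mulrC -mulrA.
have -> : expR (tau * y) * (u * expR (- (2 * tau ^+ 2))) +
  expR (tau * z) * (expR (- (2 * tau ^+ 2)) * v) =
  expR (- (2 * tau ^+ 2)) * (u * expR (tau * y) + v * expR (tau * z)) by ring.
rewrite ler_pM2l ?expR_gt0//; apply: le_trans (lerD uy vz) _.
have -> : u * (1 + tau * y + 2 * tau ^+ 2) + v * (1 + tau * z + 2 * tau ^+ 2) =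
  (u + v) * (1 + 2 * tau ^+ 2) + tau * (u * y + v * z) by ring.
by rewrite uv mean mulr0 addr0 mul1r.
Qed.

Lemma prod_supermart {R : realType} (p q : R) (phi : nat -> bool -> bool -> R) :
  (forall n a b, 0 <= phi n a b) ->
  (forall n a, kern p q a false * phi n a false + kern p q a true * phi n a true
     <= 1) ->
  supermart (fun n x b => kern p q (par n x) b)
    (fun n x => \prod_(k < n) phi k (par k x) (x k)).
Proof.
move=> phi0 phi1; split=> [n x y xy|n x|n x].
- by apply: eq_bigr => k _; rewrite xy// (par_agreeS xy)// ltnW.
- by apply: prodr_ge0.
- by rewrite !prod_upd !mulrA ![_ * \prod_(_ < _) _]mulrC -!mulrA -mulrDr
    ler_piMr ?prodr_ge0.
Qed.

Lemma exp_supermart {R : realType} (p q tau : R) (y : bool -> bool -> R) :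
  0 <= p <= 1 -> 0 <= q <= 1 ->
  (forall a, kern p q a false * y a false + kern p q a true * y a true = 0) ->
  (forall a b, `|y a b| <= 1) -> `|tau| <= 2^-1 ->
  supermart (fun n x b => kern p q (par n x) b)
    (fun n x => expR (tau * (\sum_(k < n) y (par k x) (x k)) -
                      2 * tau ^+ 2 * n%:R)).
Proof.
move=> p01 q01 mean y1 tau2.
have -> : (fun n x => expR (tau * (\sum_(k < n) y (par k x) (x k)) -
                      2 * tau ^+ 2 * n%:R)) =
  (fun n x => \prod_(k < n) expR (tau * y (par k x) (x k) - 2 * tau ^+ 2)).
  apply/funext => n; apply/funext => x.
  rewrite -expR_sum big_split/= -mulr_sumr; congr (expR (_ + _)).
  by rewrite sumr_const card_ord mulr_natr mulNrn.
apply: (prod_supermart _ _ (fun=> fun a b => expR (tau * y a b - 2 * tau ^+ 2))).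
  by move=> n a b; apply: expR_ge0.
move=> n a; apply: exp_step => //; [exact: kern_ge0|exact: kern_ge0|].
exact: kern_sum.
Qed.

(** The centred versions of the digit x_k and of the product x_(k/2) x_k, given
    the parent a = x_(k/2). *)
Definition drift1 {R : realType} (p q : R) (a b : bool) : R :=
  b%:R - p - (1 - p - q) * a%:R.

Definition drift2 {R : realType} (q : R) (a b : bool) : R :=
  (a && b)%:R - (1 - q) * a%:R.

Lemma drift1_mean {R : realType} (p q : R) a :
  kern p q a false * drift1 p q a false + kern p q a true * drift1 p q a true = 0.
Proof. by case: a; rewrite /drift1 /=; ring. Qed.

Lemma drift2_mean {R : realType} (p q : R) a :
  kern p q a false * drift2 q a false + kern p q a true * drift2 q a true = 0.
Proof. by case: a; rewrite /drift2 /=; ring. Qed.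

Lemma drift1_le1 {R : realType} {p q : R} : 0 <= p <= 1 -> 0 <= q <= 1 ->
  forall a b, `|drift1 p q a b| <= 1.
Proof.
move=> /andP[p0 p1] /andP[q0 q1] a b; rewrite ler_norml /drift1.
by case: a; case: b => /=; lra.
Qed.

Lemma drift2_le1 {R : realType} {q : R} : 0 <= q <= 1 ->
  forall a b, `|drift2 q a b| <= 1.
Proof.
move=> /andP[q0 q1] a b; rewrite ler_norml /drift2.
by case: a; case: b => /=; lra.
Qed.

Lemma sum_drift1 {R : realType} (p q : R) n x :
  \sum_(k < n) drift1 p q (par k x) (x k) =
  ones n x - p * n%:R - (1 - p - q) * ones n./2 x.
Proof.
have -> : p * n%:R = \sum_(k < n) p by rewrite sumr_const card_ord mulr_natr.
by rewrite -sum_par mulr_sumr -!sumrB.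
Qed.

Lemma sum_drift2 {R : realType} (q : R) n x :
  \sum_(k < n) drift2 q (par k x) (x k) = pairs n./2 x - (1 - q) * ones n./2 x.
Proof. by rewrite -sum_par -sum_par_digit mulr_sumr -sumrB. Qed.

(** The product of these factors is the conditional probability of the cylinder
    of length m around y, divided by its probability. After m steps along y it
    is the inverse of the weight of the cylinder. *)
Definition cover_factor {R : realType} (p q : R) (m : nat) (y : nat -> bool)
    (k : nat) (a b : bool) : R :=
  if (k < m)%N then ((a == par k y) && (b == y k))%:R / kern p q a b else 1.

Lemma cover_supermart {R : realType} (p q : R) m y :
  0 <= p <= 1 -> 0 <= q <= 1 ->
  supermart (fun n x b => kern p q (par n x) b)
    (fun n x => \prod_(k < n) cover_factor p q m y k (par k x) (x k)).
Proof.
move=> p01 q01; apply: prod_supermart => [n a b|n a]; rewrite /cover_factor.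
  by case: ifP => // _; rewrite divr_ge0// kern_ge0.
case: ifP => _; last by rewrite !mulr1 kern_sum.
have le1 b (e : bool) : kern p q a b * (e%:R / kern p q a b) <= e%:R.
  rewrite mulrCA ler_piMr//.
  by have [->|k0] := eqVneq (kern p q a b) 0; rewrite ?mul0r ?ler01// mulfV.
apply: le_trans (lerD (le1 _ _) (le1 _ _)) _.
by rewrite -natrD lern1; case: (a == _); case: (y n).
Qed.

Lemma cover_prod {R : realType} (p q : R) m y x : agree m y x ->
  \prod_(k < m) cover_factor p q m y k (par k x) (x k) = (weight p q m x)^-1.
Proof.
move=> yx; rewrite /weight -prodfV; apply: eq_bigr => k _.
rewrite /cover_factor ltn_ord (par_agreeS yx) ?(ltnW (ltn_ord k))// yx//.
by rewrite !eqxx mul1r.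
Qed.

(** * Consequences of the law of large numbers *)

(** A quantitative form of the law of large numbers for the two drifts. The
    constants C make it uniform in x, which the bound on weights requires. *)
Definition tame {R : realType} (p q : R) (C : nat -> R) (x : nat -> bool) : Prop :=
  forall j n,
    `|\sum_(k < n) drift1 p q (par k x) (x k)| <= 2^-1 ^+ j * n%:R + C j /\
    `|\sum_(k < n) drift2 q (par k x) (x k)| <= 2^-1 ^+ j * n%:R + C j.

(** By definition of the first drift, ones n is, up to a small error,
    p n + (1 - p - q) * ones n./2. As |1 - p - q| < 1, this recursion contracts
    to its fixed point, the frequency 2p / (1 + p + q). *)
Lemma ones_close {R : realType} (p q eps B : R) x :
  0 < p < 1 -> 0 < q <= 1 -> 0 <= eps -> 0 <= B ->
  (forall n, `|\sum_(k < n) drift1 p q (par k x) (x k)| <= eps * n%:R + B) ->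
  forall n, `|ones n x - 2 * p / (1 + p + q) * n%:R| <=
    2 * eps * n%:R + (B + 1) / (1 - `|1 - p - q|).
Proof.
move=> /andP[p0 p1] /andP[q0 q1] eps0 B0 x_drift.
set a := 2 * p / (1 + p + q); set r := 1 - p - q; set B' := (B + 1) / _.
have r1 : `|r| < 1 by rewrite ltr_norml /r; lra.
have r0 : 0 <= `|r| by [].
have B'0 : 0 <= B' by rewrite divr_ge0; lra.
have aE : a * (2 - r) = 2 * p by rewrite /a /r; field; lra.
have a01 : 0 <= a <= 1.
  by rewrite /a divr_ge0 ?ler_pdivrMr/=; lra.
clearbody a.
have B'E : `|r| * B' + B + 1 = B'.
  by rewrite /B'; field; rewrite gt_eqF// subr_gt0.
elim/ltn_ind => n IHn; have [->|n0] := posnP n.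
  by rewrite /ones big_ord0 mulr0 subrr normr0 mulr0 add0r.
have hn : (n./2 < n)%N.
  by rewrite ltn_half_double -addnn -[X in (X < _)%N]addn0 ltn_add2l.
have nE : n%:R = (odd n)%:R + 2 * (n./2)%:R :> R.
  by rewrite -natrM -natrD mul2n odd_double_half.
have := x_drift n; rewrite sum_drift1 -/r => drift_n.
have IH := IHn _ hn.
(* The last term comes from the rounding in n./2. *)
set M := _ - _ - _ in drift_n; set e' := ones n./2 x - _ in IH.
have -> : ones n x - a * n%:R = M + r * e' - r * a / 2 * (odd n)%:R.
  have -> : r * a / 2 * (odd n)%:R = r * a / 2 * n%:R - r * a * (n./2)%:R.
    by rewrite nE; field.
  have : a * n%:R = p * n%:R + r * a / 2 * n%:R.
    by have -> : p = a * (2 - r) / 2 by [lra]; field.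
  by rewrite /M /e' => ->; ring.
have tail : `|r * a / 2 * (odd n)%:R| <= 1.
  rewrite !normrM (ger0_norm (x := 2^-1)) ?invr_ge0//.
  have /andP[a0 a1] := a01; rewrite (ger0_norm a0) normr_nat.
  have ra : `|r| * a <= 1 by rewrite mulr_ile1// ltW.
  by case: odd; rewrite ?mulr1 ?mulr0//; have := mulr_ge0 r0 a0; lra.
have re : `|r * e'| <= eps * n%:R + `|r| * B'.
  rewrite normrM; apply: le_trans (ler_wpM2l r0 IH) _.
  have h2 : 2 * eps * (n./2)%:R <= eps * n%:R.
    by rewrite nE mulrDr mulrCA mulrA lerDr mulr_ge0.
  rewrite mulrDr lerD2r; apply: le_trans h2.
  by rewrite ler_piMl ?mulr_ge0// ltW.
apply: le_trans (ler_normB _ _) _.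
apply: le_trans (lerD (ler_normD _ _) tail) _.
by rewrite -B'E; lra.
Qed.

(** A digit 1 is followed by a digit 1 with probability 1 - q, whence the value
    of theta. *)
Lemma pairs_close {R : realType} (p q eps B theta : R) x :
  0 < p < 1 -> 0 < q <= 1 -> 0 <= eps -> 0 <= B ->
  theta = 2 * p * (1 - q) / (1 + p + q) ->
  (forall n, `|\sum_(k < n) drift1 p q (par k x) (x k)| <= eps * n%:R + B) ->
  (forall n, `|\sum_(k < n) drift2 q (par k x) (x k)| <= eps * n%:R + B) ->
  forall n, `|pairs n x - theta * n%:R| <=
    4 * eps * n%:R + (B + (B + 1) / (1 - `|1 - p - q|)).
Proof.
move=> p01 q01 eps0 B0 -> d1 d2 n.
have := ones_close _ _ _ _ _ p01 q01 eps0 B0 d1 n.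
have := d2 n.*2; rewrite sum_drift2 doubleK -[in n.*2%:R]mul2n natrM.
have /andP[p0 p1] := p01; have /andP[q0 q1] := q01.
set B' := (B + 1) / _; set a := 2 * p / (1 + p + q) => h2 h1.
have -> : 2 * p * (1 - q) / (1 + p + q) = (1 - q) * a by rewrite /a; ring.
have -> : pairs n x - (1 - q) * a * n%:R =
  (pairs n x - (1 - q) * ones n x) + (1 - q) * (ones n x - a * n%:R) by ring.
apply: le_trans (ler_normD _ _) _.
have h3 : `|(1 - q) * (ones n x - a * n%:R)| <= `|ones n x - a * n%:R|.
  by rewrite normrM ler_piMl// ler_norml; lra.
by apply: le_trans (lerD h2 (le_trans h3 h1)) _; lra.
Qed.

Lemma tame_close {R : realType} (p q theta e : R) C :
  0 < p < 1 -> 0 < q <= 1 -> theta = 2 * p * (1 - q) / (1 + p + q) ->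
  (forall j, 0 <= C j) -> 0 < e ->
  exists2 B, 0 <= B & forall x, tame p q C x -> forall n,
    `|ones n x - 2 * p / (1 + p + q) * n%:R| <= e * n%:R + B /\
    `|pairs n x - theta * n%:R| <= e * n%:R + B.
Proof.
move=> p01 q01 thetaE C0 e0.
have half01 : 0 <= (2 : R)^-1 < 1 by rewrite invr_ge0 ler0n/= invf_lt1 ?ltr1n.
have e4 : 0 < e / 4 by rewrite divr_gt0.
have [j jP] := expr_small half01 e4.
have ej := jP _ (leqnn j).
have eps0 : 0 <= (2 : R)^-1 ^+ j by rewrite exprn_ge0// invr_ge0.
have r1 : 0 < 1 - `|1 - p - q|.
  have /andP[p0 p1] := p01; have /andP[q0 q1] := q01.
  by rewrite subr_gt0 ltr_norml; lra.
have B'0 : 0 <= (C j + 1) / (1 - `|1 - p - q|).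
  by rewrite divr_ge0 ?(ltW r1)// addr_ge0.
exists (C j + (C j + 1) / (1 - `|1 - p - q|)); first by rewrite addr_ge0.
move=> x x_tame n.
have d1 m := (x_tame j m).1; have d2 m := (x_tame j m).2.
have /(_ n) h1 := ones_close _ _ _ _ _ p01 q01 eps0 (C0 j) d1.
have /(_ n) h2 := pairs_close _ _ _ _ _ _ p01 q01 eps0 (C0 j) thetaE d1 d2.
have n0 : 0 <= n%:R :> R by [].
have en : 2^-1 ^+ j * n%:R <= e / 4 * n%:R by rewrite ler_wpM2r.
have := C0 j; split; [apply: le_trans h1 _|apply: le_trans h2 _].
  have : 0 <= e * n%:R by rewrite mulr_ge0// ltW.
  lra.
lra.
Qed.

Lemma tame_level_set {R : realType} (p q theta : R) C (x : Sigma2 R) :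
  0 < p < 1 -> 0 < q <= 1 -> theta = 2 * p * (1 - q) / (1 + p + q) ->
  (forall j, 0 <= C j) -> tame p q C x -> level_set theta x.
Proof.
move=> p01 q01 thetaE C0 x_tame; apply/level_setE/cvgrPdist_le => e e0.
have e2 : 0 < e / 2 by rewrite divr_gt0.
have [B B0 xB] := tame_close _ _ _ _ _ p01 q01 thetaE C0 e2.
near=> n.
have n0 : 0 < n%:R :> R by rewrite ltr0n; near: n; exists 1%N.
have [_ pn] := xB x x_tame n.
have -> : theta - n%:R^-1 * pairs n x = - (n%:R^-1 * (pairs n x - theta * n%:R)).
  by field; rewrite gt_eqF.
rewrite normrN normrM gtr0_norm ?invr_gt0// mulrC ler_pdivrMr//.
apply: le_trans pn _.
suff : B <= e / 2 * n%:R by lra.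
rewrite mulrC -ler_pdivrMr//; near: n; exact: nbhs_infty_ger.
Unshelve. all: by end_near.
Qed.

(** On tame sequences both frequencies converge, so the formula of ln_weight has
    the rate dim_formula theta p q, uniformly. *)
Lemma tame_weight_le {R : realType} (p q theta s : R) C :
  0 < p < 1 -> 0 < q <= 1 -> p ^+ 2 * q = (1 - p) ^+ 3 ->
  theta = 2 * p * (1 - q) / (1 + p + q) -> (forall j, 0 <= C j) ->
  s < dim_formula theta p q ->
  exists B, forall x, tame p q C x -> (forall k, 0 < kern p q (par k x) (x k)) ->
    forall n, weight p q n x <= (2 `^ (- s)) ^+ n * expR B.
Proof.
move=> p01 q01 pq thetaE C0 sF.
have /andP[p0 p1] := p01; have /andP[q0 q1] := q01.
have FE := dim_formulaE theta p q.
set F := dim_formula theta p q in sF FE.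
set c := ln (p / (1 - p)); set D := ln ((1 - q) * (1 - p) / (q * p)) in FE *.
have ln2 : 0 < ln 2 :> R by rewrite ln_gt0// ltr1n.
pose Q := 2 * `|c| + `|D| + 1.
have Q0 : 0 < Q by rewrite /Q; have := normr_ge0 c; have := normr_ge0 D; lra.
pose e := (F - s) * ln 2 / Q.
have e0 : 0 < e by rewrite divr_gt0// mulr_gt0// subr_gt0.
have eQ : e * Q = (F - s) * ln 2 by rewrite /e divfK// gt_eqF.
have [B B0 xB] := tame_close _ _ _ _ _ p01 q01 thetaE C0 e0.
exists (`|c| * (3 * B + 1) + `|D| * (B + 1)) => x x_tame xpos n.
have W0 : 0 < weight p q n x by apply: prodr_gt0 => k _.
rewrite -ler_ln ?posrE ?mulr_gt0 ?exprn_gt0 ?powR_gt0 ?expR_gt0//.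
rewrite lnM ?posrE ?exprn_gt0 ?powR_gt0 ?expR_gt0// expRK lnXn ?powR_gt0//.
rewrite ln_powR (ln_weight p01 q01 pq)// -/c -/D -(mulr_natl (- s * ln 2)).
have [z1 _] := xB _ x_tame n; have [z2 z3] := xB _ x_tame n./2.
have nE : n%:R = (odd n)%:R + 2 * (n./2)%:R :> R.
  by rewrite -natrM -natrD mul2n odd_double_half.
have odd01 : 0 <= ((odd n)%:R : R) <= 1 by case: odd; rewrite ?lexx ?ler01.
set a := 2 * p / (1 + p + q) in z1 z2.
have a01 : 0 <= a <= 1 by rewrite /a divr_ge0 ?ler_pdivrMr/=; lra.
have th_a : theta = a * (1 - q) by rewrite thetaE /a; ring.
clearbody a.
have th01 : 0 <= theta <= 1.
  have /andP[a0 a1] := a01.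
  by rewrite th_a mulr_ge0 ?mulr_ile1//; lra.
set N := n%:R in z1 nE *; set H := (n./2)%:R in z2 z3 nE.
set od := (odd n)%:R in nE odd01.
have N0 : 0 <= N by [].
have H0 : 0 <= H by [].
have a_odd : 0 <= a * od <= 1.
  by case/andP: a01 => *; case/andP: odd01 => *; rewrite mulr_ge0// mulr_ile1.
have t_odd : 0 <= theta * od <= 1.
  by case/andP: th01 => *; case/andP: odd01 => *; rewrite mulr_ge0// mulr_ile1.
have c1 : c * (ones n x - 2 * ones n./2 x) <= `|c| * (2 * (e * N) + 3 * B + 1).
  apply: le_trans (ler_norm _) _; rewrite normrM ler_wpM2l//.
  have -> : ones n x - 2 * ones n./2 x =
    (ones n x - a * N) - 2 * (ones n./2 x - a * H) + a * od by rewrite nE; ring.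
  have e_odd : 0 <= e * od by case/andP: odd01 => *; rewrite mulr_ge0// ltW.
  have eN : e * N = e * od + 2 * (e * H) by rewrite nE; ring.
  by move: z1 z2; rewrite !ler_norml; lra.
have d1 : D * pairs n./2 x <= D * (theta / 2 * N) + `|D| * (e * N + B + 1).
  have -> : D * pairs n./2 x = D * (theta / 2 * N) +
    D * (pairs n./2 x - theta / 2 * N) by ring.
  rewrite lerD2l; apply: le_trans (ler_norm _) _; rewrite normrM ler_wpM2l//.
  have -> : pairs n./2 x - theta / 2 * N =
    (pairs n./2 x - theta * H) - theta * od / 2 by rewrite nE; field.
  have e_odd : 0 <= e * od by case/andP: odd01 => *; rewrite mulr_ge0// ltW.
  have eH : 0 <= e * H by rewrite mulr_ge0// ltW.
  have eN : e * N = e * od + 2 * (e * H) by rewrite nE; ring.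
  by move: z3; rewrite !ler_norml; lra.
have FN : N * (F * ln 2) = N * (- ln (1 - p) - theta / 2 * D) by rewrite FE.
have eQN : N * e * (2 * `|c| + `|D|) <= N * ((F - s) * ln 2).
  rewrite -eQ -mulrA ler_wpM2l// ler_wpM2l ?(ltW e0)// /Q; lra.
lra.
Qed.

Lemma exp_bound {R : realType} (tau S m E : R) : 0 < tau -> 0 < E ->
  expR (tau * S - 2 * tau ^+ 2 * m) <= E -> S <= 2 * tau * m + ln E / tau.
Proof.
move=> tau0 E0; rewrite -{1}(lnK E0) ler_expR => h.
rewrite -(ler_pM2l tau0).
have -> : tau * (2 * tau * m + ln E / tau) = 2 * tau ^+ 2 * m + ln E.
  by field; rewrite gt_eqF.
lra.
Qed.

(** * Lower bound *)

(** Exponential supermartingales that penalize deviations of both drifts, in both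
    directions, at the scale tau = 2 ^- j.+1. *)
Definition deviation {R : realType} (p q : R) (j n : nat) (x : nat -> bool) : R :=
  let E tau (y : bool -> bool -> R) :=
    expR (tau * (\sum_(k < n) y (par k x) (x k)) - 2 * tau ^+ 2 * n%:R) in
  let tau := 2^-1 ^+ j.+1 in
  (E tau (drift1 p q) + E (- tau) (drift1 p q)) +
  (E tau (drift2 q) + E (- tau) (drift2 q)).

Lemma deviation_supermart {R : realType} (p q : R) j :
  0 <= p <= 1 -> 0 <= q <= 1 ->
  supermart (fun n x b => kern p q (par n x) b) (deviation p q j).
Proof.
move=> p01 q01.
have tau2 : `|(2 : R)^-1 ^+ j.+1| <= 2^-1.
  rewrite ger0_norm ?exprn_ge0 ?invr_ge0// exprS ler_piMr ?invr_ge0//.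
  by rewrite exprn_ile1 ?invr_ge0// invf_le1 ?ler1n.
have tau2N : `|- (2 : R)^-1 ^+ j.+1| <= 2^-1 by rewrite normrN.
apply: supermartD; apply: supermartD; apply: exp_supermart => //.
- exact: drift1_mean.
- exact: drift1_le1.
- exact: drift1_mean.
- exact: drift1_le1.
- exact: drift2_mean.
- exact: drift2_le1.
- exact: drift2_mean.
- exact: drift2_le1.
Qed.

Lemma deviation0 {R : realType} (p q : R) j x : deviation p q j 0 x = 4.
Proof. by rewrite /deviation !big_ord0 !mulr0 subr0 expR0; ring. Qed.

(** What remains of the bound 8 * 2 ^ j.+1 on a deviation after taking logarithms
    and dividing by tau. *)
Definition slack {R : realType} (j : nat) : R := ln (8 * 2 ^+ j.+1) * 2 ^+ j.+1.

Lemma slack_ge0 {R : realType} j : 0 <= slack j :> R.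
Proof.
rewrite /slack mulr_ge0 ?exprn_ge0// ln_ge0//.
by rewrite mulr_ege1 ?ler1n// exprn_ege1// ler1n.
Qed.

Lemma deviation_tame {R : realType} (p q : R) x :
  (forall j n, deviation p q j n x <= 8 * 2 ^+ j.+1) -> tame p q slack x.
Proof.
move=> xdev j n; set tau : R := 2^-1 ^+ j.+1.
have tau0 : 0 < tau by rewrite exprn_gt0 ?invr_gt0.
have E0 : 0 < 8 * 2 ^+ j.+1 :> R by rewrite mulr_gt0 ?exprn_gt0.
have bd S : expR (tau * S - 2 * tau ^+ 2 * n%:R) <= 8 * 2 ^+ j.+1 ->
    S <= 2^-1 ^+ j * n%:R + slack j.
  move=> /(exp_bound _ _ _ _ tau0 E0).
  have -> : 2 * tau = 2^-1 ^+ j by rewrite /tau exprS mulrA mulfV// mul1r.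
  by have -> : tau^-1 = 2 ^+ j.+1 by rewrite /tau exprVn invrK.
have := xdev j n; rewrite /deviation -/tau.
set S1 := \sum_(k < n) drift1 _ _ _ _; set S2 := \sum_(k < n) drift2 _ _ _.
have NS S : - tau * S = tau * - S by rewrite mulrN mulNr.
rewrite sqrrN !NS.
move: (expR_ge0 (tau * S1 - 2 * tau ^+ 2 * n%:R)).
move: (expR_ge0 (tau * (- S1) - 2 * tau ^+ 2 * n%:R)).
move: (expR_ge0 (tau * S2 - 2 * tau ^+ 2 * n%:R)).
move: (expR_ge0 (tau * (- S2) - 2 * tau ^+ 2 * n%:R)).
move=> e1 e2 e3 e4 sum_le.
by split; rewrite ler_norml lerNl !bd//; lra.
Qed.

(** Suppose that a cover is too cheap. Sum the deviations of all scales, with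
    total 1/2 at the root, and K times the supermartingales of the cylinders of
    the cover, each with its price as initial value. Along a greedy path the
    deviations stay bounded, so the path is tame, belongs to the level set, and is
    covered by some cylinder; at the end of that cylinder its supermartingale is
    the price divided by the weight, which is at least expR (- B). With K = 2 expR B
    this exceeds the bound 1. *)
Lemma level_set_dim_ge {R : realType} (theta p q : R) :
  0 < p < 1 -> 0 < q <= 1 -> p ^+ 2 * q = (1 - p) ^+ 3 ->
  theta = 2 * p * (1 - q) / (1 + p + q) ->
  ((dim_formula theta p q)%:E <= hausdorff_dim (level_set theta))%E.
Proof.
move=> p01 q01 pq thetaE; apply: hausdorff_dim_ge => s /andP[s0 sF].
have p01' : 0 <= p <= 1 by case/andP: p01 => *; rewrite !ltW.
have q01' : 0 <= q <= 1 by case/andP: q01 => q0 ->; rewrite ltW.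
have [B Bw] := tame_weight_le _ _ _ _ _ p01 q01 pq thetaE slack_ge0 sF.
pose K := 2 * expR B.
have K0 : 0 < K by rewrite mulr_gt0 ?expR_gt0.
(* At this price, the cylinders have total 1/2 at the root. *)
exists (1 / 2 / K); first by rewrite !divr_gt0.
move=> m y w w0 cover sum_w.
pose t n x b := kern p q (par n x) b.
pose h i n x := \prod_(k < n) cover_factor p q (m i) (y i) k (par k x) (x k).
pose g i n x := (8 * 2 ^+ i.+1)^-1 * deviation p q i n x + K * w i * h i n x.
have c0 i : 0 < (8 * 2 ^+ i.+1)^-1 :> R by rewrite invr_gt0 mulr_gt0// exprn_gt0.
have dev_sm i : supermart t (deviation p q i) by apply: deviation_supermart.
have h_sm i : supermart t (h i) by apply: cover_supermart.
have Kw0 i : 0 <= K * w i by rewrite mulr_ge0// ltW.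
have g_sm i : supermart t (g i).
  by apply: supermartD; apply: supermartZ => //; apply: ltW.
have g_sum N : \sum_(i < N) g i 0%N xpred0 <= 1.
  rewrite big_split/=.
  have -> : \sum_(i < N) K * w i * h i 0%N xpred0 = K * \sum_(i < N) w i.
    by rewrite mulr_sumr; apply: eq_bigr => i _; rewrite /h big_ord0 mulr1.
  have -> : \sum_(i < N) (8 * 2 ^+ i.+1)^-1 * deviation p q i 0 xpred0 =
      1 / 2 - 1 / 2 * 2^-1 ^+ N.
    elim: N => [|N IHN]; first by rewrite big_ord0 expr0; lra.
    rewrite big_ord_recr/= IHN deviation0 !exprVn !exprS.
    have : (2 : R) ^+ N != 0 by rewrite expf_neq0.
    by move: ((2 : R) ^+ N) => u u0; field; rewrite u0.
  have half : K * (1 / 2 / K) = 1 / 2 by field; rewrite gt_eqF.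
  have := ler_wpM2l (ltW K0) (sum_w N); rewrite half.
  have : 0 <= (2 : R)^-1 ^+ N by rewrite exprn_ge0 ?invr_ge0.
  lra.
have [x xP] : exists x, forall n, 0 < t n x (x n) /\ forall i, g i n x <= 1.
  apply: (greedy_path t g 1 _ _ _ g_sm g_sum) => [n x y' b xy|n x b|n x].
  - by rewrite /t (par_agree xy).
  - exact: kern_ge0.
  - exact: kern_sum.
have part i n : (8 * 2 ^+ i.+1)^-1 * deviation p q i n x <= 1 /\
    K * w i * h i n x <= 1.
  have := (xP n).2 i; rewrite /g.
  have := mulr_ge0 (ltW (c0 i)) (supermart_ge0 _ _ (dev_sm i) n x).
  have := mulr_ge0 (Kw0 i) (supermart_ge0 _ _ (h_sm i) n x).
  by move=> ? ? ?; split; lra.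
have x_tame : tame p q slack x.
  apply: deviation_tame => i n; have [+ _] := part i n.
  by rewrite mulrC ler_pdivrMr ?mul1r// -invr_gt0.
have x_level : level_set theta (x : Sigma2 R).
  by apply: (tame_level_set p q theta slack) => //; apply: slack_ge0.
have [i [xi wi]] := cover x x_level.
have xpos k : 0 < kern p q (par k x) (x k) by have [] := xP k.
have W0 : 0 < weight p q (m i) x by apply: prodr_gt0 => k _.
have := (part i (m i)).2; rewrite /h cover_prod// ler_pdivrMr// mul1r.
have := Bw x x_tame xpos (m i) => le_W le_Kw.
have w_gt0 : 0 < w i by apply: lt_le_trans wi; rewrite exprn_gt0 ?powR_gt0.
have := ler_wpM2r (expR_ge0 B) wi => le_w.
have := le_trans le_Kw (le_trans le_W le_w).
rewrite /K; have : 0 < expR B * w i by rewrite mulr_gt0 ?expR_gt0.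
lra.
Qed.

(** * The curve of parameters *)

(** The pairs (p, q) of the statement lie on a curve, here parametrized by p.
    The parameter theta increases along it from 0, at the point p0 where q = 1,
    to 1, at p = 1 where q = 0. *)
Definition curve_q {R : realType} (p : R) : R := (1 - p) ^+ 3 / p ^+ 2.

Definition curve_theta {R : realType} (p : R) : R :=
  2 * p * (1 - curve_q p) / (1 + p + curve_q p).

Lemma root_mono {R : realType} (s t : R) : 0 < s < 1 -> 0 < t < 1 ->
  s ^+ 2 <= (1 - s) ^+ 3 -> (1 - t) ^+ 3 <= t ^+ 2 -> s <= t.
Proof.
move=> /andP[s0 s1] /andP[t0 t1] hs ht; rewrite leNgt; apply/negP => ts.
have h1 : t ^+ 2 < s ^+ 2 by rewrite ltr_pXn2r ?nnegrE ?(ltW s0) ?(ltW t0).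
have h2 : (1 - s) ^+ 3 < (1 - t) ^+ 3.
  by rewrite ltr_pXn2r ?nnegrE ?subr_ge0 ?(ltW s1) ?(ltW t1)// ltrD2l ltrN2.
lra.
Qed.

Lemma exists_p0 {R : realType} :
  exists p0 : R, unique (fun t : R => 0 < t < 1 /\ t ^+ 2 = (1 - t) ^+ 3) p0.
Proof.
pose P : {poly R} := 'X^2 - (1 - 'X) ^+ 3.
have PE t : P.[t] = t ^+ 2 - (1 - t) ^+ 3 by rewrite /P !hornerE.
have [||p0 /andP[p00 p01] rp0] := @poly_ivt R P 0 1.
- by rewrite ler01.
- by rewrite !PE; apply/andP; split; lra.
have Pp0 : p0 ^+ 2 = (1 - p0) ^+ 3.
  by apply/eqP; rewrite -subr_eq0 -PE; exact: rp0.
have p0I : 0 < p0 < 1.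
  apply/andP; split; rewrite lt_neqAle ?p00 ?p01 andbT.
    by apply/eqP => p0E; move: Pp0; rewrite -p0E; lra.
  by apply/eqP => p0E; move: Pp0; rewrite p0E; lra.
exists p0; split=> // t [t01 Pt]; apply/eqP; rewrite eq_le.
by apply/andP; split; apply: root_mono => //; rewrite ?Pt ?Pp0.
Qed.

Lemma pq_systemE {R : realType} {theta p q : R} :
  pq_system theta p q -> q = curve_q p.
Proof.
rewrite /curve_q; move=> [pq /andP[p0 _] _ _].
by rewrite -pq mulrC mulKf// expf_neq0// gt_eqF.
Qed.

Lemma pq_system_curve {R : realType} (p : R) : 0 < p < 1 -> (1 - p) ^+ 3 < p ^+ 2 ->
  pq_system (curve_theta p) p (curve_q p).
Proof.
move=> p01 lt_p; rewrite /curve_theta; have /andP[p0 p1] := p01; split=> //.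
  by rewrite /curve_q mulrC divfK// expf_neq0// gt_eqF.
by rewrite divr_gt0 ?exprn_gt0 ?subr_gt0//= ltr_pdivrMr ?exprn_gt0// mul1r.
Qed.

Lemma pq_system_theta {R : realType} {theta p q : R} :
  pq_system theta p q -> 0 < theta < 1.
Proof.
move=> [_ /andP[p0 p1] /andP[q0 q1] ->]; have d0 : 0 < 1 + p + q by lra.
rewrite divr_gt0 ?mulr_gt0 ?subr_gt0//= ltr_pdivrMr// mul1r.
have := mulr_gt0 p0 q0; lra.
Qed.

(** Both p and 1 - q increase along the curve, and so does theta as a function
    of them. *)
Lemma pq_system_mono {R : realType} {theta1 theta2 p1 p2 q1 q2 : R} :
  pq_system theta1 p1 q1 -> pq_system theta2 p2 q2 -> p1 < p2 -> theta1 < theta2.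
Proof.
move=> [pq1 /andP[a0 a1] /andP[b0 b1] ->] [pq2 /andP[c0 c1] /andP[d0 d1] ->] ac.
have db : q2 < q1.
  rewrite ltNge; apply/negP => bd.
  have h1 : p1 ^+ 2 * q1 <= p2 ^+ 2 * q2.
    apply: ler_pM => //; rewrite ?exprn_ge0 ?(ltW a0) ?(ltW b0)//.
    by rewrite ler_pXn2r ?nnegrE ?(ltW a0) ?(ltW c0)// ltW.
  have h2 : (1 - p2) ^+ 3 < (1 - p1) ^+ 3.
    by rewrite ltr_pXn2r ?nnegrE ?subr_ge0 ?(ltW a1) ?(ltW c1)// ltrD2l ltrN2.
  lra.
have u0 : 0 < 1 - q1 by lra.
rewrite ltr_pdivrMr; last by lra.
rewrite [ltRHS]mulrAC ltr_pdivlMr; last by lra.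
(* In terms of p and u = 1 - q, the claim is polynomial. *)
have -> : q1 = 1 - (1 - q1) by ring.
have -> : q2 = 1 - (1 - q2) by ring.
have : 1 - q1 < 1 - q2 by lra.
have : 1 - q2 < 1 by lra.
move: (1 - q1) (1 - q2) u0 => u v u0 v1 uv.
have h1 : 0 < p1 * p2 * (v - u) by rewrite !mulr_gt0// subr_gt0.
have h2 : 0 < (p2 - p1) * (2 * v - u * v).
  by rewrite mulr_gt0 ?subr_gt0//; nra.
have h3 : 0 < p1 * (v - u) by rewrite mulr_gt0// subr_gt0.
nra.
Qed.

Lemma pq_system_lt {R : realType} {theta1 theta2 p1 p2 q1 q2 : R} :
  pq_system theta1 p1 q1 -> pq_system theta2 p2 q2 -> theta1 < theta2 -> p1 < p2.
Proof.
move=> s1 s2 lt12; case: (ltgtP p1 p2) => // [p21|p12].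
  by have := pq_system_mono s2 s1 p21; rewrite ltNge (ltW lt12).
have q12 : q1 = q2 by rewrite (pq_systemE s1) (pq_systemE s2) p12.
by move: s1 s2 lt12 => [_ _ _ ->] [_ _ _ ->]; rewrite p12 q12 ltxx.
Qed.

Lemma pq_system_gt {R : realType} {theta p q p0 : R} :
  0 < p0 < 1 -> p0 ^+ 2 = (1 - p0) ^+ 3 -> pq_system theta p q -> p0 < p.
Proof.
move=> p0I Pp0 [pq p01 /andP[q0 q1] _].
have lt_p : (1 - p) ^+ 3 < p ^+ 2.
  by rewrite -pq -[ltRHS]mulr1 ltr_pM2l// exprn_gt0//; case/andP: p01.
have := root_mono p0 p p0I p01 _ _; rewrite Pp0 lexx ltW// => /(_ isT isT).
rewrite le_eqVlt => /orP[/eqP p0E|//].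
by move: lt_p; rewrite -p0E Pp0 ltxx.
Qed.

Lemma curve_gt {R : realType} {p p0 : R} :
  0 < p0 < 1 -> p0 ^+ 2 = (1 - p0) ^+ 3 -> p0 < p < 1 -> (1 - p) ^+ 3 < p ^+ 2.
Proof.
move=> /andP[p00 p01] Pp0 /andP[p0p p1]; have p_gt0 := lt_trans p00 p0p.
apply: (@lt_trans _ _ (p0 ^+ 2)).
  rewrite Pp0 ltr_pXn2r ?nnegrE ?subr_ge0 ?(ltW p1) ?(ltW p01)//.
  by rewrite ltrD2l ltrN2.
by rewrite ltr_pXn2r ?nnegrE ?(ltW p00) ?(ltW p_gt0).
Qed.

Lemma pq_system_exists {R : realType} (theta : R) : 0 < theta < 1 ->
  exists! pq : R * R, pq_system theta pq.1 pq.2.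
Proof.
move=> /andP[t0 t1]; have [p0 [[p0I Pp0] _]] := @exists_p0 R.
have /andP[p00 p01] := p0I.
(* The equation for theta with q = curve_q p, after clearing denominators. *)
pose P : {poly R} := 2%:P * 'X * ('X^2 - (1 - 'X) ^+ 3)
  - theta%:P * ('X^2 + 'X^3 + (1 - 'X) ^+ 3).
have PE t : P.[t] = 2 * t * (t ^+ 2 - (1 - t) ^+ 3)
    - theta * (t ^+ 2 + t ^+ 3 + (1 - t) ^+ 3) by rewrite /P !hornerE.
have Pp0_lt : P.[p0] < 0.
  rewrite PE Pp0 subrr mulr0 sub0r oppr_lt0 mulr_gt0//.
  by rewrite !addr_gt0// exprn_gt0// subr_gt0.
have P1_gt : 0 < P.[1] by rewrite PE; lra.
have [||p /andP[p0p p1] rp] := @poly_ivt R P p0 1.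
- exact: ltW.
- by rewrite !ltW.
have {rp}Pp : P.[p] = 0 by apply/eqP.
have {}p1 : p < 1.
  by rewrite lt_neqAle p1 andbT; apply/eqP => pE; rewrite -pE Pp ltxx in P1_gt.
have {}p0p : p0 < p.
  by rewrite lt_neqAle p0p andbT; apply/eqP => pE; rewrite pE Pp ltxx in Pp0_lt.
have p_gt0 := lt_trans p00 p0p.
have := pq_system_curve p; rewrite p_gt0 p1 => /(_ isT).
have p0p1 : p0 < p < 1 by rewrite p0p.
move=> /(_ (curve_gt p0I Pp0 p0p1)) sys.
have thetaE : curve_theta p = theta.
  have d0 : 0 < p ^+ 2 + p ^+ 3 + (1 - p) ^+ 3.
    by rewrite !addr_gt0// exprn_gt0// subr_gt0.
  have -> : theta = 2 * p * (p ^+ 2 - (1 - p) ^+ 3) /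
      (p ^+ 2 + p ^+ 3 + (1 - p) ^+ 3).
    have -> : 2 * p * (p ^+ 2 - (1 - p) ^+ 3) =
        theta * (p ^+ 2 + p ^+ 3 + (1 - p) ^+ 3).
      by apply/eqP; rewrite -subr_eq0 -PE Pp.
    by rewrite mulfK// gt_eqF.
  by rewrite /curve_theta /curve_q; field; rewrite !gt_eqF//; lra.
exists (p, curve_q p); split=> [|[p' q'] /= sys']; first by rewrite -thetaE.
rewrite thetaE in sys.
have pE : p = p'.
  case: (ltgtP p p') => // [/(pq_system_mono sys sys')|/(pq_system_mono sys' sys)];
  by rewrite ltxx.
by rewrite (pq_systemE sys') pE.
Qed.

(** With ln q eliminated, all terms are nonnegative for theta in [0, 1]. *)
Lemma dim_formula_alt {R : realType} {theta p q : R} :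
  0 < p < 1 -> 0 < q < 1 -> p ^+ 2 * q = (1 - p) ^+ 3 ->
  dim_formula theta p q * ln 2 =
  - ((1 - theta) * ln (1 - p)) - theta / 2 * (ln (1 - q) + ln p).
Proof.
move=> /andP[p0 p1] /andP[q0 q1] pq; rewrite dim_formulaE.
have p1' : 0 < 1 - p by rewrite subr_gt0.
have q1' : 0 < 1 - q by rewrite subr_gt0.
have := congr1 (@ln R) pq; rewrite lnM ?posrE ?exprn_gt0// !lnXn// => lpq.
rewrite !(ln_div, lnM) ?posrE ?mulr_gt0//.
have -> : ln q = 3 * ln (1 - p) - 2 * ln p by lra.
by field.
Qed.

Lemma dim_formula_ge0 {R : realType} {theta p q : R} :
  0 <= theta <= 1 -> 0 < p < 1 -> 0 < q < 1 -> p ^+ 2 * q = (1 - p) ^+ 3 ->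
  0 <= dim_formula theta p q.
Proof.
move=> /andP[t0 t1] p01 q01 pq.
have ln2 : 0 < ln 2 :> R by rewrite ln_gt0// ltr1n.
rewrite -(pmulr_lge0 _ ln2) (dim_formula_alt p01 q01 pq).
have /andP[p0 p1] := p01; have /andP[q0 q1] := q01.
have l1 : 0 <= - ln (1 - p) by rewrite oppr_ge0 ln_le0//; lra.
have l2 : 0 <= - ln (1 - q) by rewrite oppr_ge0 ln_le0//; lra.
have l3 : 0 <= - ln p by rewrite oppr_ge0 ln_le0// ltW.
have t1' : 0 <= 1 - theta by rewrite subr_ge0.
have t2 : 0 <= theta / 2 by rewrite divr_ge0.
have := mulr_ge0 t1' l1; have := mulr_ge0 t2 l2; have := mulr_ge0 t2 l3.
lra.
Qed.

(** * Limits at the ends of the curve *)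

(** The function ln vanishes on nonpositive reals, so this is two-sided
    continuity, with value 0 at 0. *)
Lemma continuous_xlnx0 {R : realType} :
  {for (0 : R), continuous (fun y : R => y * ln y)}.
Proof.
apply/cvgrPdist_le => e e0; rewrite mul0r.
pose d := Num.min 1 ((e / 2) ^+ 2).
have d0 : 0 < d by rewrite lt_min ltr01 exprn_gt0// divr_gt0.
near=> y; rewrite sub0r normrN.
have yd : `|y| < d by near: y; exact: (@nbhs0_lt R R).
have [y0|y0] := leP y 0; first by rewrite ln0// mulr0 normr0 ltW.
move: yd; rewrite gtr0_norm// lt_min => /andP[y1 ye].
have sq : Num.sqrt y ^+ 2 = y by rewrite sqr_sqrtr// ltW.
have s0 : 0 < Num.sqrt y by rewrite sqrtr_gt0.
have se : Num.sqrt y < e / 2.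
  by rewrite -(ltr_pXn2r (n := 2)) ?nnegrE ?(ltW s0) ?divr_ge0 ?(ltW e0)// sq.
have lny : ln y <= 0 by rewrite ln_le0// ltW.
rewrite ler0_norm ?mulr_ge0_le0 ?(ltW y0)//.
have ls : - ln (Num.sqrt y) <= (Num.sqrt y)^-1 - 1.
  have := @le_ln1Dx R ((Num.sqrt y)^-1 - 1).
  rewrite addrCA subrr addr0 lnV ?posrE//; apply.
  by rewrite ltrBDl subrr invr_gt0.
(* With r = sqrt y, the bound - ln r <= r^-1 - 1 yields - y ln y <= 2 r. *)
move: (Num.sqrt y) sq s0 se ls => r <- r0 re ls.
rewrite lnXn//; have := ler_wpM2l (sqr_ge0 r) ls.
have -> : r ^+ 2 * (r^-1 - 1) = r - r ^+ 2 by field; rewrite gt_eqF.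
by have := sqr_ge0 r; lra.
Unshelve. all: by end_near.
Qed.

(** Since theta increases with p, being below the parameter of a given point of
    the curve forces p below that point. *)
Lemma p_cvg0 {R : realType} (p q : R -> R) (p0 : R)
    (sys : forall theta, 0 < theta < 1 -> pq_system theta (p theta) (q theta))
    (p0I : 0 < p0 < 1) (Pp0 : p0 ^+ 2 = (1 - p0) ^+ 3) :
  p theta @[theta --> 0^'+] --> p0.
Proof.
have /andP[p00 p01] := p0I.
apply/cvgrPdist_le => e e0; pose p1 := p0 + Num.min e ((1 - p0) / 2).
have m0 : 0 < Num.min e ((1 - p0) / 2).
  by rewrite lt_min e0 divr_gt0 ?subr_gt0.
have m1 : Num.min e ((1 - p0) / 2) <= (1 - p0) / 2 by rewrite ge_min lexx orbT.
have m2 : Num.min e ((1 - p0) / 2) <= e by rewrite ge_min lexx.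
have p1I : p0 < p1 < 1 by rewrite /p1; lra.
have p1I' : 0 < p1 < 1 by lra.
have sys1 := pq_system_curve _ p1I' (curve_gt p0I Pp0 p1I).
have /andP[t1 t11] := pq_system_theta sys1.
near=> theta.
have th0 : 0 < theta by near: theta; exact: nbhs_right_gt.
have th1 : theta < curve_theta p1 by near: theta; apply: nbhs_right_lt.
have thI : 0 < theta < 1 by rewrite th0 (lt_trans th1).
have hi := pq_system_lt (sys _ thI) sys1 th1.
have lo := pq_system_gt p0I Pp0 (sys _ thI).
by rewrite ler0_norm; rewrite /p1 in hi; lra.
Unshelve. all: by end_near.
Qed.

Lemma p_cvg1 {R : realType} (p q : R -> R) (p0 : R)
    (sys : forall theta, 0 < theta < 1 -> pq_system theta (p theta) (q theta))
    (p0I : 0 < p0 < 1) (Pp0 : p0 ^+ 2 = (1 - p0) ^+ 3) :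
  p theta @[theta --> 1^'-] --> (1 : R).
Proof.
have /andP[p00 p01] := p0I.
apply/cvgrPdist_le => e e0; pose p1 := 1 - Num.min e ((1 - p0) / 2).
have m0 : 0 < Num.min e ((1 - p0) / 2).
  by rewrite lt_min e0 divr_gt0 ?subr_gt0.
have m1 : Num.min e ((1 - p0) / 2) <= (1 - p0) / 2 by rewrite ge_min lexx orbT.
have m2 : Num.min e ((1 - p0) / 2) <= e by rewrite ge_min lexx.
have p1I : p0 < p1 < 1 by rewrite /p1; lra.
have p1I' : 0 < p1 < 1 by lra.
have sys1 := pq_system_curve _ p1I' (curve_gt p0I Pp0 p1I).
have /andP[t1 t11] := pq_system_theta sys1.
near=> theta.
have th0 : theta < 1 by near: theta; exact: nbhs_left_lt.
have th1 : curve_theta p1 < theta by near: theta; apply: nbhs_left_gt.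
have thI : 0 < theta < 1 by rewrite th0 (lt_trans _ th1).
have lo := pq_system_lt sys1 (sys _ thI) th1.
have [_ /andP[_ hi] _ _] := sys _ thI.
by rewrite ger0_norm; rewrite /p1 in lo; lra.
Unshelve. all: by end_near.
Qed.

Lemma near0_unit {R : realType} : \forall theta \near (0 : R)^'+, 0 < theta < 1.
Proof.
near=> theta; apply/andP; split; near: theta;
  [exact: nbhs_right_gt|exact: nbhs_right_lt].
Unshelve. all: by end_near.
Qed.

Lemma near1_unit {R : realType} : \forall theta \near (1 : R)^'-, 0 < theta < 1.
Proof.
near=> theta; apply/andP; split; near: theta;
  [exact: nbhs_left_gt|exact: nbhs_left_lt].
Unshelve. all: by end_near.
Qed.

(** The dimension as a function of p alone, times ln 2, written so that the
    logarithms of 1 - p and 1 - q, singular at the two ends of the curve, occur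
    only in the form y * ln y. It is therefore continuous up to both ends. *)
Definition curve_dim {R : realType} (p : R) : R :=
  - ((1 - p) * ln (1 - p) *
     ((1 + (1 - p) ^+ 2 * (1 + 2 * p) / p ^+ 2) / (1 + p + curve_q p)))
  - (1 - curve_q p) * ln (1 - curve_q p) * (p / (1 + p + curve_q p))
  - p * (1 - curve_q p) / (1 + p + curve_q p) * ln p.

Lemma curve_dimE {R : realType} {theta p q : R} : pq_system theta p q ->
  dim_formula theta p q = curve_dim p / ln 2.
Proof.
move=> sys; have qE : q = curve_q p := pq_systemE sys.
have [pq p01 q01 thetaE] := sys; have /andP[p0 p1] := p01.
have /andP[q0 q1] := q01.
have ln2 : ln 2 != 0 :> R by rewrite gt_eqF// ln_gt0// ltr1n.
apply: (mulIf ln2); rewrite divfK// (dim_formula_alt p01 q01 pq) /curve_dim -qE.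
have -> : (1 - p) * ln (1 - p) *
    ((1 + (1 - p) ^+ 2 * (1 + 2 * p) / p ^+ 2) / (1 + p + q)) =
  (1 - theta) * ln (1 - p).
  have -> : (1 - p) * ln (1 - p) *
      ((1 + (1 - p) ^+ 2 * (1 + 2 * p) / p ^+ 2) / (1 + p + q)) =
    ln (1 - p) * ((1 - p) + ((1 - p) ^+ 3 / p ^+ 2) * (1 + 2 * p)) / (1 + p + q).
    by field; rewrite !gt_eqF//; lra.
  by rewrite -/(curve_q p) -qE thetaE; field; rewrite gt_eqF//; lra.
rewrite thetaE; field; rewrite gt_eqF//; lra.
Qed.

Lemma continuous_xlnx {R : realType} (y : R) : 0 <= y ->
  {for y, continuous (fun y : R => y * ln y)}.
Proof.
rewrite le_eqVlt => /orP[/eqP <-|y0]; first exact: continuous_xlnx0.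
by apply: cvgM; [exact: cvg_id|exact: continuous_ln].
Qed.

Lemma continuous_curve_q {R : realType} (p : R) : 0 < p ->
  {for p, continuous (@curve_q R)}.
Proof.
move=> p0; apply: cvgM.
  apply: (continuous_cvg _ (h := fun y : R => y ^+ 3)).
    exact: exprn_continuous.
  by apply: cvgB; [exact: cvg_cst|exact: cvg_id].
apply: cvgV; first by rewrite expf_neq0// gt_eqF.
exact: exprn_continuous.
Qed.

Lemma continuous_curve_dim {R : realType} (p : R) :
  0 < p <= 1 -> curve_q p <= 1 -> {for p, continuous (@curve_dim R)}.
Proof.
move=> /andP[p0 p1] q1.
have q0 : 0 <= curve_q p by rewrite divr_ge0 ?exprn_ge0// ?subr_ge0// ltW.
have cq : curve_q x @[x --> p] --> curve_q p := continuous_curve_q _ p0.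
have cp : x @[x --> p] --> p by exact: cvg_id.
have c1p : 1 - x @[x --> p] --> 1 - p by apply: cvgB => //; exact: cvg_cst.
have c1q : 1 - curve_q x @[x --> p] --> 1 - curve_q p.
  by apply: cvgB => //; exact: cvg_cst.
have cden : (1 + x + curve_q x)^-1 @[x --> p] --> (1 + p + curve_q p)^-1.
  apply: cvgV; first by rewrite gt_eqF//; lra.
  by apply: cvgD => //; apply: cvgD => //; exact: cvg_cst.
have csqr : (x ^+ 2)^-1 @[x --> p] --> (p ^+ 2)^-1.
  apply: cvgV; first by rewrite expf_neq0// gt_eqF.
  exact: exprn_continuous.
have c1p2 : (1 - x) ^+ 2 @[x --> p] --> (1 - p) ^+ 2.
  apply: (continuous_cvg _ (h := fun y : R => y ^+ 2)) => //.
  exact: exprn_continuous.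
apply: cvgB; [apply: cvgB; [apply: cvgN; apply: cvgM|apply: cvgM]|apply: cvgM].
- apply: (continuous_cvg _ (h := fun y : R => y * ln y)) => //.
  by apply: continuous_xlnx; rewrite subr_ge0.
- apply: cvgM => //; apply: cvgD; first exact: cvg_cst.
  apply: cvgM => //; apply: cvgM => //; apply: cvgD; first exact: cvg_cst.
  by apply: cvgM => //; exact: cvg_cst.
- apply: (continuous_cvg _ (h := fun y : R => y * ln y)) => //.
  by apply: continuous_xlnx; rewrite subr_ge0.
- exact: cvgM.
- by apply: cvgM => //; apply: cvgM.
- exact: continuous_ln.
Qed.

Lemma dim_formula_cvg {R : realType} (p q : R -> R) (F : set_system R)
    {FF : Filter F} (l : R) :
  (forall theta, 0 < theta < 1 -> pq_system theta (p theta) (q theta)) ->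
  (\forall theta \near F, 0 < theta < 1) ->
  0 < l <= 1 -> curve_q l <= 1 -> p theta @[theta --> F] --> l ->
  dim_formula theta (p theta) (q theta) @[theta --> F] --> curve_dim l / ln 2.
Proof.
move=> sys Fu l01 ql pl.
apply: (cvg_trans (G := curve_dim (p theta) / ln 2 @[theta --> F])).
  apply: near_eq_cvg; near=> theta.
  have thI : 0 < theta < 1 by near: theta.
  by rewrite (curve_dimE (sys _ thI)).
apply: cvgMr_tmp; apply: (continuous_cvg _ (h := @curve_dim R)) => //.
exact: continuous_curve_dim.
Unshelve. all: by end_near.
Qed.

Lemma lee_cvg {R : realType} (F : set_system R) {FF : ProperFilter F}
    (x : \bar R) (g : R -> R) (l : R) :
  (\forall t \near F, (x <= (g t)%:E)%E) -> g t @[t --> F] --> l -> (x <= l%:E)%E.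
Proof.
move=> xg /cvgrPdist_le gl; apply/lee_addgt0Pr => e e0.
have [t [xt lt]] := filter_ex (filterI xg (gl e e0)).
apply: le_trans xt _; rewrite -EFinD lee_fin.
by move: lt; rewrite ler_norml; lra.
Qed.

(** * The dimension of the level sets *)

Theorem theorem1 (R : realType) :
  (forall theta : R, 0 < theta < 1 ->
     exists! pq : R * R, pq_system theta pq.1 pq.2) /\
  (forall p q : R -> R,
     (forall theta : R, 0 < theta < 1 -> pq_system theta (p theta) (q theta)) ->
     let f := fun theta : R => dim_formula theta (p theta) (q theta) in
     [/\ forall theta : R, 0 < theta < 1 ->
           hausdorff_dim (level_set theta) = (f theta)%:E,
         exists p0 : R,
           [/\ unique (fun t : R => 0 < t < 1 /\ t ^+ 2 = (1 - t) ^+ 3) p0,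
               f theta @[theta --> 0^'+] --> - log2 (1 - p0) &
               hausdorff_dim (level_set (0 : R)) = (- log2 (1 - p0))%:E] &
         f theta @[theta --> 1^'-] --> (0 : R) /\
         hausdorff_dim (level_set (1 : R)) = 0%E]).
Proof.
split; first exact: pq_system_exists.
move=> p q sys f.
have [p0 p0uniq] := @exists_p0 R.
have [[p0I Pp0] _] := p0uniq; have /andP[p00 p01] := p0I.
have pc0 := p_cvg0 p q p0 sys p0I Pp0.
have pc1 := p_cvg1 p q p0 sys p0I Pp0.
have le_dim eta theta : 0 <= eta <= 1 -> 0 < theta < 1 ->
    (hausdorff_dim (level_set eta) <=
     (dim_formula eta (p theta) (q theta))%:E)%E.
  move=> eta01 thI; have [pq pI qI _] := sys _ thI.
  by apply: level_set_dim_le => //; apply: dim_formula_ge0.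
have q_p0 : curve_q p0 = 1.
  by rewrite /curve_q -Pp0 divff// expf_neq0// gt_eqF.
have q_1 : curve_q (1 : R) = 0 by rewrite /curve_q subrr expr0n mul0r.
split.
- move=> theta thI; have [pq pI /andP[q0 q1] thE] := sys _ thI.
  apply/eqP; rewrite eq_le le_dim//=; last by case/andP: thI => *; rewrite !ltW.
  by apply: level_set_dim_ge => //; rewrite q0 ltW.
- exists p0; split=> //.
    have -> : - log2 (1 - p0) = curve_dim p0 / ln 2.
      rewrite /curve_dim q_p0 subrr !(mul0r, mulr0) !subr0 /log2 -mulNr.
      congr (_ / _); congr (- _).
      have -> : (1 - p0) * ln (1 - p0) *
          ((1 + (1 - p0) ^+ 2 * (1 + 2 * p0) / p0 ^+ 2) / (1 + p0 + 1)) =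
        ln (1 - p0) *
          ((1 - p0 + (1 - p0) ^+ 3 / p0 ^+ 2 * (1 + 2 * p0)) / (1 + p0 + 1)).
        by field; rewrite !gt_eqF//; lra.
      by rewrite -/(curve_q p0) q_p0; field; rewrite gt_eqF//; lra.
    apply: (dim_formula_cvg p q) => //; first exact: near0_unit.
      by rewrite p00 ltW.
    by rewrite q_p0.
  apply/eqP; rewrite eq_le; apply/andP; split; last first.
    have -> : - log2 (1 - p0) = dim_formula 0 p0 1.
      by rewrite /dim_formula mul0r mul0r subr0.
    apply: level_set_dim_ge => //; first by rewrite ltr01 lexx.
      by rewrite mulr1.
    by rewrite subrr mulr0 mul0r.
  apply: (@lee_cvg _ 0^'+ _ _ (fun theta => dim_formula 0 (p theta) (q theta))).
    have := @near0_unit R; apply: filterS => theta thI.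
    by apply: le_dim; rewrite ?lexx ?ler01.
  rewrite /dim_formula mul0r.
  apply: (cvg_trans (G := - log2 (1 - p theta) @[theta --> 0^'+])).
    by apply: near_eq_cvg; near=> theta; rewrite mul0r subr0.
  apply: cvgN; apply: cvgMr_tmp; apply: continuous_cvg.
    by apply: continuous_ln; rewrite subr_gt0.
  by apply: cvgB => //; exact: cvg_cst.
- split.
    have -> : 0 = curve_dim 1 / ln 2 :> R.
      by rewrite /curve_dim q_1 !subrr subr0 ln1 !(mul0r, mulr0) !subr0 oppr0 mul0r.
    apply: (dim_formula_cvg p q) => //; first exact: near1_unit.
      by rewrite ltr01 lexx.
    by rewrite q_1 ler01.
  apply/eqP; rewrite eq_le; apply/andP; split; last first.
    by apply: le_ereal_inf_tmp => _ [s [s0 _] <-]; rewrite lee_fin.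
  apply: (@lee_cvg _ 1^'- _ _ (fun theta => dim_formula 1 (p theta) (q theta))).
    have := @near1_unit R; apply: filterS => theta thI.
    by apply: le_dim; rewrite ?lexx ?ler01.
  have -> : 0 = - (1 / 2 * (ln (1 - curve_q 1) + ln 1)) / ln 2 :> R.
    by rewrite q_1 subr0 ln1 addr0 mulr0 oppr0 mul0r.
  apply: (cvg_trans (G := - (1 / 2 * (ln (1 - curve_q (p theta)) + ln (p theta)))
       / ln 2 @[theta --> 1^'-])).
    apply: near_eq_cvg; near=> theta.
    have thI : 0 < theta < 1 by near: theta; exact: near1_unit.
    have [pq pI qI _] := sys _ thI.
    have ln2 : ln 2 != 0 :> R by rewrite gt_eqF// ln_gt0// ltr1n.
    apply: (mulIf ln2); rewrite divfK// (dim_formula_alt pI qI pq).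
    by rewrite subrr mul0r oppr0 sub0r -(pq_systemE (sys _ thI)).
  apply: cvgMr_tmp; apply: cvgN; apply: cvgMl_tmp; apply: cvgD.
    apply: continuous_cvg; first by apply: continuous_ln; rewrite q_1 subr0.
    apply: cvgB; first exact: cvg_cst.
    by apply: continuous_cvg => //; apply: continuous_curve_q.
  by apply: continuous_cvg => //; apply: continuous_ln.
Unshelve. all: by end_near.
Qed.
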